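(* (i) For every computable metric space $(X,A,\nu,d)$ (i.e. with $\nu$ total) and its numbering $\beta$ of open balls and strong inclusion $\mathring{\subseteq}$ described in the context, one has \[ \rho_{\beta}^{\max}\equiv\rho_{Cau}\equiv\rho_{\beta}^{\mathring{\subseteq}}\le\rho_{\beta}^{\min}, \] and the last reduction can be strict: there exists a computable metric space for which $\rho_{\beta}^{\min}\not\le\rho_{Cau}$. (ii) For every non-necessarily effectively separable computable metric space $(X,A,\nu,d)$ (with $\nu$ possibly partial), one has \[ \rho_{\beta}^{\max}\le\rho_{Cau}\equiv\rho_{\beta}^{\mathring{\subseteq}}\le\rho_{\beta}^{\min}, \] and each of the two reductions $\le$ can be strict: there exists such a space with $\rho_{Cau}\not\le\rho_{\beta}^{\max}$, and there exists such a space with $\rho_{\beta}^{\min}\not\le\rho_{Cau}$.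
   Context: Multi-representations: a multi-representation of a set $X$ is a partial multi-valued map $\rho:\subseteq\mathbb{N}^{\mathbb{N}}\rightrightarrows X$, i.e. an assignment $f\mapsto\rho(f)\subseteq X$ with $\text{dom}(\rho)=\{f:\rho(f)\neq\emptyset\}$, such that every $x\in X$ lies in $\rho(f)$ for some $f$; $f$ is a $\rho$-name of $x$ if $x\in\rho(f)$. For multi-representations $\rho_1,\rho_2$ of $X$, $\rho_1\le\rho_2$ means there is a computable partial function $F:\subseteq\mathbb{N}^{\mathbb{N}}\to\mathbb{N}^{\mathbb{N}}$ (computable by a Type-2 Turing machine) defined on $\text{dom}(\rho_1)$ with $\rho_1(f)\subseteq\rho_2(F(f))$ for all $f\in\text{dom}(\rho_1)$; $\rho_1\equiv\rho_2$ means $\rho_1\le\rho_2$ and $\rho_2\le\rho_1$. Metric setting: a non-necessarily effectively separable computable metric space is a quadruple $(X,A,\nu,d)$ where $(X,d)$ is a metric space, $A\subseteq X$ is countable and dense, $\nu:\subseteq\mathbb{N}\to A$ is a partial surjection, and $d$ is computable on $A$ with respect to $\nu$: there is an algorithm which, given $n,m\in\text{dom}(\nu)$ and $k\in\mathbb{N}$, outputs a rational within $2^{-k}$ of $d(\nu(n),\nu(m))$. It is a computable metric space if moreover $\nu$ is total. Let $c_{\mathbb{Q}}$ be a standard total numbering of $\mathbb{Q}$ and $\langle\cdot,\cdot\rangle$ a computable pairing function. The numbering $\beta$ of open balls: $\text{dom}(\beta)=\{\langle n,m\rangle: n\in\text{dom}(\nu),\ c_{\mathbb{Q}}(m)>0\}$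 and $\beta(\langle n,m\rangle)=B(\nu(n),c_{\mathbb{Q}}(m))$ (open ball). The strong inclusion on $\text{dom}(\beta)$: $\langle n_1,m_1\rangle\mathring{\subseteq}\langle n_2,m_2\rangle$ iff $d(\nu(n_1),\nu(n_2))+c_{\mathbb{Q}}(m_1)<c_{\mathbb{Q}}(m_2)$. Cauchy representation $\rho_{Cau}$: $p\in\text{dom}(\rho_{Cau})$ iff $p\in\text{dom}(\nu)^{\mathbb{N}}$, $d(\nu(p(i)),\nu(p(j)))<2^{-j}$ for all $i>j$, and $(\nu(p(i)))_i$ converges in $X$; then $\rho_{Cau}(p)=\lim_i\nu(p(i))$. Representations from the numbered family $(\mathfrak{B},\beta)$ (here $\mathfrak{B}$ is the set of balls): let $\Delta$ be the standard numbering of finite subsets of $\mathbb{N}$; the induced numbered basis $\hat\beta$ has $\text{dom}(\hat\beta)=\{n:\Delta_n\subseteq\text{dom}(\beta)\}$ and $\hat\beta(n)=\bigcap_{k\in\Delta_n}\beta(k)$ (with the empty intersection equal to $X$). The strong inclusion is extended to $\text{dom}(\hat\beta)$ by $n_1\mathring{\subseteq}n_2$ iff for every $k\in\Delta_{n_2}$ there is $p\in\Delta_{n_1}$ with $p\mathring{\subseteq}k$. Then: $x\in\rho_\beta^{\min}(f)$ iff every $f(n)\in\text{dom}(\beta)$ with $x\in\beta(f(n))$, and for every $B\in\mathfrak{B}$ with $x\in B$ there are $n_1,\dots,n_k$ with $\beta(f(n_1))\cap\dots\cap\beta(f(n_k))\subseteq B$; $x\in\rho_\beta^{\max}(f)$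 iff $\text{Im}(f)=\{n\in\text{dom}(\beta):x\in\beta(n)\}$; $x\in\rho_\beta^{\mathring{\subseteq}}(f)$ iff every $b\in\text{Im}(f)$ lies in $\text{dom}(\hat\beta)$ with $x\in\hat\beta(b)$, and for every $b_1\in\text{dom}(\hat\beta)$ with $x\in\hat\beta(b_1)$ there is $b_2\in\text{Im}(f)$ with $b_2\mathring{\subseteq}b_1$. *)

(* Defs.v *)
From Stdlib Require Import Reals Lra Lia ZArith QArith Qreals List Arith Cantor.
From Stdlib Require Import Classical ClassicalEpsilon.
Set Implicit Arguments.
Open Scope R_scope.

(** * Computability *)

Definition npair (m n : nat) : nat := Cantor.to_nat (m, n).
Definition nfst (z : nat) : nat := fst (Cantor.of_nat z).
Definition nsnd (z : nat) : nat := snd (Cantor.of_nat z).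

Definition Baire : Type := nat -> nat.

(** The model of computation is Kleene's: partial recursive functions relative
    to an oracle [f : Baire], in the unary presentation where several arguments
    are passed through the pairing function. *)
Inductive code : Type :=
| c_zero | c_succ | c_left | c_right
| c_oracle
| c_pair (a b : code)
| c_comp (a b : code)
| c_prec (a b : code)
| c_mu (a : code).

(** [eval f c x y]: with oracle [f], the computation [c] on input [x] halts
    with output [y].
    - [c_prec a b] maps [npair x 0] to [a x] and [npair x (k+1)] to
      [b (npair x (npair k r))], where [r] is its value at [npair x k];
    - [c_mu a] maps [x] to the least [y] with [a (npair x y) = 0], all the
      earlier values being required to be defined. *)
Fixpoint eval (f : Baire) (c : code) : nat -> nat -> Prop :=
  match c with
  | c_zero => fun _ y => y = 0%nat
  | c_succ => fun x y => y = S x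
  | c_left => fun x y => y = nfst x
  | c_right => fun x y => y = nsnd x
  | c_oracle => fun x y => y = f x
  | c_pair a b => fun x y =>
      exists u v, eval f a x u /\ eval f b x v /\ y = npair u v
  | c_comp a b => fun x y => exists u, eval f b x u /\ eval f a u y
  | c_prec a b => fun x =>
      nat_rect (fun _ => nat -> Prop)
        (eval f a (nfst x))
        (fun k value y =>
           exists r, value r /\ eval f b (npair (nfst x) (npair k r)) y)
        (nsnd x)
  | c_mu a => fun x y =>
      eval f a (npair x y) 0%nat /\
      forall i, (i < y)%nat -> exists r, eval f a (npair x i) (S r)
  end.

(** Computation without oracle: a constant oracle carries no information. *)
Definition eval0 : code -> nat -> nat -> Prop := eval (fun _ => 0%nat).

(** [c] computes the partial function on Baire space whose value at [f] is the
    [g] such that [g n] is the output of [c] on input [n] with oracle [f]. *)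
Definition computes (c : code) (f g : Baire) : Prop :=
  forall n, eval f c n (g n).

(** * Multi-representations *)

Record multirep (X : Type) : Type := {
  names :> Baire -> X -> Prop;
  names_surj : forall x, exists f, names f x }.

Definition rep_dom (X : Type) (rho : multirep X) (f : Baire) : Prop :=
  exists x, rho f x.

Definition rep_le (X : Type) (rho1 rho2 : multirep X) : Prop :=
  exists c, forall f, rep_dom rho1 f ->
    exists g, computes c f g /\ forall x, rho1 f x -> rho2 g x.

Definition rep_equiv (X : Type) (rho1 rho2 : multirep X) : Prop :=
  rep_le rho1 rho2 /\ rep_le rho2 rho1.

(** * Representations induced by a numbered family of subsets

    A numbering of subsets of [X] is given by its domain [dom] and by the
    relation [beta n x], read "[x] belongs to the set numbered [n]". *)

(** [n] belongs to the finite set with canonical index [e]. *)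
Definition in_Delta (e n : nat) : Prop := Nat.testbit e n = true.

Definition hat_dom (dom : nat -> Prop) (e : nat) : Prop :=
  forall k, in_Delta e k -> dom k.

Definition hat (X : Type) (beta : nat -> X -> Prop) (e : nat) (x : X) : Prop :=
  forall k, in_Delta e k -> beta k x.

Definition hat_incl (incl : nat -> nat -> Prop) (e1 e2 : nat) : Prop :=
  forall k, in_Delta e2 k -> exists p, in_Delta e1 p /\ incl p k.

Definition min_names (X : Type) (dom : nat -> Prop) (beta : nat -> X -> Prop)
    (f : Baire) (x : X) : Prop :=
  (forall n, dom (f n) /\ beta (f n) x) /\
  (forall b, dom b -> beta b x ->
     exists l : list nat,
       forall y, (forall n, In n l -> beta (f n) y) -> beta b y).

Definition max_names (X : Type) (dom : nat -> Prop) (beta : nat -> X -> Prop)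
    (f : Baire) (x : X) : Prop :=
  forall b, (exists n, f n = b) <-> dom b /\ beta b x.

Definition incl_names (X : Type) (dom : nat -> Prop) (beta : nat -> X -> Prop)
    (incl : nat -> nat -> Prop) (f : Baire) (x : X) : Prop :=
  (forall n, hat_dom dom (f n) /\ hat beta (f n) x) /\
  (forall b, hat_dom dom b -> hat beta b x -> exists n, hat_incl incl (f n) b).

(** * Computable metric spaces *)

(** Every rational is of the form [(i - j) / (k + 1)]. *)
Definition c_Q (n : nat) : Q :=
  Qmake (Z.of_nat (nfst n) - Z.of_nat (nfst (nsnd n)))
        (Pos.of_succ_nat (nsnd (nsnd n))).

(** Countability of [A] is a consequence of [nu_surj]. *)
Record nes_metric_space : Type := {
  space : Metric_Space;
  A : Base space -> Prop;
  nu : nat -> option (Base space);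
  nu_in : forall n a, nu n = Some a -> A a;
  nu_surj : forall a, A a -> exists n, nu n = Some a;
  A_dense : forall x eps, 0 < eps -> exists a, A a /\ dist space a x < eps;
  dist_computable : exists c : code, forall n m k a b,
    nu n = Some a -> nu m = Some b ->
    exists q, eval0 c (npair n (npair m k)) q /\
              Rabs (Q2R (c_Q q) - dist space a b) <= (/ 2) ^ k }.

Record computable_metric_space : Type := {
  nes :> nes_metric_space;
  nu_total : forall n, exists a, nu nes n = Some a }.

Definition point (M : nes_metric_space) : Type := Base (space M).

Definition radius (b : nat) : R := Q2R (c_Q (nsnd b)).

Definition ball_dom (M : nes_metric_space) (b : nat) : Prop :=
  (exists a, nu M (nfst b) = Some a) /\ 0 < radius b.

Definition ball (M : nes_metric_space) (b : nat) (x : point M) : Prop :=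
  exists a, nu M (nfst b) = Some a /\ dist (space M) a x < radius b.

Definition ball_incl (M : nes_metric_space) (b1 b2 : nat) : Prop :=
  exists a1 a2, nu M (nfst b1) = Some a1 /\ nu M (nfst b2) = Some a2 /\
    dist (space M) a1 a2 + radius b1 < radius b2.

Definition Cau_names (M : nes_metric_space) (p : Baire) (x : point M) : Prop :=
  exists s : nat -> point M,
    (forall i, nu M (p i) = Some (s i)) /\
    (forall i j, (j < i)%nat -> dist (space M) (s i) (s j) < (/ 2) ^ j) /\
    Un_cv (fun i => dist (space M) (s i) x) 0.

(** * Every point has a name *)

Lemma enumerable_image (P : nat -> Prop) :
  (exists n, P n) -> exists f : Baire, forall b, (exists n, f n = b) <-> P b.
Proof.
intros [n0 H0].
exists (fun n => if excluded_middle_informative (P n) then n else n0).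
intros b; split.
- intros [n <-]. now destruct (excluded_middle_informative (P n)).
- intros H. exists b. now destruct (excluded_middle_informative (P b)).
Qed.

Lemma nfst_pair (m n : nat) : nfst (npair m n) = m.
Proof. unfold nfst, npair. now rewrite cancel_of_to. Qed.

Lemma nsnd_pair (m n : nat) : nsnd (npair m n) = n.
Proof. unfold nsnd, npair. now rewrite cancel_of_to. Qed.

Lemma small_radius (eps : R) :
  0 < eps -> exists m, 0 < Q2R (c_Q m) < eps.
Proof.
intros H. destruct (archimed_cor1 eps H) as [N [HN HN0]].
exists (npair 1 (npair 0 (pred N))).
unfold c_Q. rewrite !nsnd_pair, !nfst_pair.
replace (Z.of_nat 1 - Z.of_nat 0)%Z with 1%Z by lia.
unfold Q2R; simpl Qnum; simpl Qden.
replace (IZR (Z.pos (Pos.of_succ_nat (pred N)))) with (INR N).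
- assert (0 < / INR N) by (apply Rinv_0_lt_compat, lt_0_INR; lia).
  lra.
- rewrite INR_IZR_INZ. f_equal. lia.
Qed.

Lemma small_ball (M : nes_metric_space) (x : point M) (eps : R) : 0 < eps ->
  exists b, ball_dom M b /\ ball M b x /\ radius b < eps.
Proof.
intros H. destruct (small_radius H) as [m [Hm Hme]].
destruct (A_dense M x Hm) as [a [Ha Hax]].
destruct (nu_surj M a Ha) as [n Hn].
exists (npair n m). unfold ball_dom, ball, radius.
rewrite nfst_pair, nsnd_pair. repeat split; eauto.
Qed.

Lemma max_surj (M : nes_metric_space) (x : point M) :
  exists f, max_names (ball_dom M) (ball M) f x.
Proof.
apply (enumerable_image (fun b => ball_dom M b /\ ball M b x)).
destruct (small_ball M x Rlt_0_1) as [b Hb]. exists b; tauto.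
Qed.

Lemma min_surj (M : nes_metric_space) (x : point M) :
  exists f, min_names (ball_dom M) (ball M) f x.
Proof.
destruct (max_surj M x) as [f Hf]. exists f; split.
- intros n. apply Hf. now exists n.
- intros b Hd Hb. destruct (proj2 (Hf b) (conj Hd Hb)) as [n Hn].
  exists (n :: nil). intros y Hy. rewrite <- Hn. apply Hy. now left.
Qed.

Lemma hat_room (M : nes_metric_space) (x : point M) (e K : nat) :
  hat (ball M) e x ->
  exists eps, 0 < eps /\ forall k, (k < K)%nat -> in_Delta e k ->
    exists a, nu M (nfst k) = Some a /\ dist (space M) a x + eps <= radius k.
Proof.
intros He. induction K as [|K [eps [Heps IH]]].
- exists 1. split; [lra|]. intros; lia.
- destruct (classic (in_Delta e K)) as [HK|HK].
  + destruct (He K HK) as [a [Ha Hax]].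
    exists (Rmin eps (radius K - dist (space M) a x)). split.
    { apply Rmin_glb_lt; lra. }
    intros k Hk Hek. destruct (Nat.eq_dec k K) as [->|Hne].
    * exists a; split; auto.
      pose proof (Rmin_r eps (radius K - dist (space M) a x)). lra.
    * destruct (IH k) as [a' [Ha' Hax']]; [lia|auto|]. exists a'; split; auto.
      pose proof (Rmin_l eps (radius K - dist (space M) a x)). lra.
  + exists eps; split; auto. intros k Hk Hek.
    destruct (Nat.eq_dec k K) as [->|Hne]; [contradiction|].
    apply IH; auto; lia.
Qed.

Lemma incl_surj (M : nes_metric_space) (x : point M) :
  exists f, incl_names (ball_dom M) (ball M) (ball_incl M) f x.
Proof.
destruct (enumerable_image
  (fun e => hat_dom (ball_dom M) e /\ hat (ball M) e x)) as [f Hf].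
{ exists 0%nat. split; intros k Hk; unfold in_Delta in Hk;
    rewrite Nat.bits_0 in Hk; discriminate. }
exists f; split.
{ intros n. apply Hf. now exists n. }
intros e _ He. destruct (hat_room (S e) He) as [eps [Heps Hroom]].
destruct (@small_ball M x (eps / 2) ltac:(lra)) as [b [Hbd [Hb Hbr]]].
assert (Hin : forall k, in_Delta (2 ^ b) k -> k = b).
{ intros k Hk. destruct (Nat.eq_dec b k) as [|Hne]; auto.
  unfold in_Delta in Hk. rewrite Nat.pow2_bits_false in Hk; auto. discriminate. }
destruct (proj2 (Hf (2 ^ b)%nat)) as [n Hn].
{ split; intros k Hk; now rewrite (Hin k Hk). }
exists n. rewrite Hn. intros k Hk. exists b. split.
{ apply Nat.pow2_bits_true. }
destruct (Hroom k) as [a2 [Ha2 Hd2]]; auto.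
{ destruct (Nat.lt_ge_cases k (S e)) as [|Hge]; auto.
  unfold in_Delta in Hk. destruct (Nat.eq_dec e 0) as [->|He0].
  - now rewrite Nat.bits_0 in Hk.
  - rewrite Nat.bits_above_log2 in Hk; [discriminate|].
    pose proof (Nat.log2_lt_lin e). lia. }
destruct Hb as [a1 [Ha1 Hd1]]. exists a1, a2. repeat split; auto.
pose proof (dist_tri (space M) a1 a2 x). pose proof (dist_sym (space M) x a2).
lra.
Qed.

Lemma Cau_surj (M : nes_metric_space) (x : point M) :
  exists p, Cau_names M p x.
Proof.
assert (H : forall i, exists na : nat * point M,
  nu M (fst na) = Some (snd na) /\ dist (space M) (snd na) x < (/ 2) ^ (i + 1)).
{ intros i. destruct (A_dense M x (eps := (/ 2) ^ (i + 1))) as [a [Ha Hax]].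
  { apply pow_lt; lra. }
  destruct (nu_surj M a Ha) as [n Hn]. now exists (n, a). }
set (t := fun i => proj1_sig (constructive_indefinite_description _ (H i))).
assert (Ht : forall i, nu M (fst (t i)) = Some (snd (t i)) /\
                       dist (space M) (snd (t i)) x < (/ 2) ^ (i + 1)).
{ intros i. exact (proj2_sig (constructive_indefinite_description _ (H i))). }
exists (fun i => fst (t i)), (fun i => snd (t i)). repeat split.
- intros i. apply Ht.
- intros i j Hij.
  pose proof (proj2 (Ht i)). pose proof (proj2 (Ht j)).
  pose proof (dist_tri (space M) (snd (t i)) (snd (t j)) x).
  pose proof (dist_sym (space M) x (snd (t j))).
  assert ((/ 2) ^ (i + 1) <= (/ 2) ^ (j + 1)).
  { rewrite !pow_inv. apply Rinv_le_contravar; [apply pow_lt; lra|].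
    apply Rle_pow; [lra|lia]. }
  assert ((/ 2) ^ (j + 1) = (/ 2) ^ j / 2) by (rewrite pow_add; simpl; lra).
  lra.
- intros eps Heps.
  destruct (pow_lt_1_zero (/ 2)) with (y := eps) as [N HN]; auto.
  { rewrite Rabs_pos_eq; lra. }
  exists N. intros i Hi. unfold Rdist. rewrite Rminus_0_r.
  pose proof (dist_pos (space M) (snd (t i)) x).
  rewrite Rabs_pos_eq by lra.
  specialize (HN (i + 1)%nat ltac:(lia)).
  rewrite Rabs_pos_eq in HN by (apply pow_le; lra).
  pose proof (proj2 (Ht i)). lra.
Qed.

Definition rho_min (M : nes_metric_space) : multirep (point M) :=
  {| names := min_names (ball_dom M) (ball M); names_surj := min_surj M |}.

Definition rho_max (M : nes_metric_space) : multirep (point M) :=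
  {| names := max_names (ball_dom M) (ball M); names_surj := max_surj M |}.

Definition rho_incl (M : nes_metric_space) : multirep (point M) :=
  {| names := incl_names (ball_dom M) (ball M) (ball_incl M);
     names_surj := incl_surj M |}.

Definition rho_Cau (M : nes_metric_space) : multirep (point M) :=
  {| names := Cau_names M; names_surj := Cau_surj M |}.

(* Main.v *)
(** Every reduction out of [rho_max] or [rho_incl] only searches a name for balls
    of small radius, a test on coded rationals that involves no distance.
    Conversely the balls of radius [2 * 2^-n] around the entries of a Cauchy name
    form a neighbourhood basis made of strong inclusions. Distances are needed only
    for [rho_Cau <= rho_max], which dovetails over all balls and so needs a total
    [nu].

    For the strictness of [rho_incl <= rho_min], put on [nat] the metric with
    [d (2n) (2n+1) = delta n <= 1] and all other distances [1], where [delta n < 1]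
    iff the code number [n] answers when its oracle repeats forever the unit ball
    around [2n]. If the reduction has number [n] and never answers, that ball is
    [{2n}] and the oracle was a genuine name of [2n]; if it answers, it has read a
    finite prefix only, which extends to a name of [2n] as well as to a name of
    [2n+1]. For this to be a computable metric space one needs Kleene's T predicate,
    and a witness of halting is taken to be a finite set of triples
    (code, input, output), each of which follows from others by one clause of [eval].

    For the strictness of [rho_max <= rho_Cau], take a one-point space and a domain
    of [nu] that diagonalises against the countably many codes: a computable Cauchy
    name exists, while a [rho_max]-name enumerates the domain of [nu]. *)

Require Import Defs.
From Stdlib Require Import Reals Qreals Lra Lia List Arith Cantor.
From Stdlib Require Import Classical ClassicalEpsilon.
Set Implicit Arguments.
Unset Strict Implicit.
Open Scope nat_scope.

(** * Computable functions and decidable relations *)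

Definition computable (F : Baire -> nat -> nat) : Prop :=
  exists c, forall f x, eval f c x (F f x).

(** Truth is the value [0], as tested by [c_mu]. *)
Definition dec (P : Baire -> nat -> Prop) : Prop :=
  exists F, computable F /\ forall f x, F f x = 0 <-> P f x.

Lemma computable_ext (F G : Baire -> nat -> nat) :
  (forall f x, F f x = G f x) -> computable F -> computable G.
Proof.
intros H [c Hc]. exists c. intros f x. rewrite <- H. apply Hc.
Qed.

Lemma dec_rel_iff (P Q : Baire -> nat -> Prop) :
  (forall f x, P f x <-> Q f x) -> dec P -> dec Q.
Proof.
intros H [F [HF HP]]. exists F. split; auto.
intros f x. rewrite HP. apply H.
Qed.

Lemma computable_comp (F G : Baire -> nat -> nat) :
  computable F -> computable G -> computable (fun f x => F f (G f x)).
Proof.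
intros [a Ha] [b Hb]. exists (c_comp a b). intros f x. simpl. eauto.
Qed.

Lemma computable_zero : computable (fun _ _ => 0).
Proof. exists c_zero. reflexivity. Qed.

Lemma computable_S (F : Baire -> nat -> nat) :
  computable F -> computable (fun f x => S (F f x)).
Proof.
apply (@computable_comp (fun _ x => S x)). exists c_succ. reflexivity.
Qed.

Lemma computable_const (n : nat) : computable (fun _ _ => n).
Proof.
induction n; [apply computable_zero | now apply computable_S].
Qed.

Lemma computable_nfst (F : Baire -> nat -> nat) :
  computable F -> computable (fun f x => nfst (F f x)).
Proof.
apply (@computable_comp (fun _ x => nfst x)). exists c_left. reflexivity.
Qed.

Lemma computable_nsnd (F : Baire -> nat -> nat) :
  computable F -> computable (fun f x => nsnd (F f x)).
Proof.
apply (@computable_comp (fun _ x => nsnd x)). exists c_right. reflexivity.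
Qed.

Lemma computable_oracle (F : Baire -> nat -> nat) :
  computable F -> computable (fun f x => f (F f x)).
Proof.
apply (@computable_comp (fun f x => f x)). exists c_oracle. reflexivity.
Qed.

Lemma computable_npair (F G : Baire -> nat -> nat) :
  computable F -> computable G -> computable (fun f x => npair (F f x) (G f x)).
Proof.
intros [a Ha] [b Hb]. exists (c_pair a b). intros f x. simpl. eauto 6.
Qed.

Lemma npair_nfst_nsnd (z : nat) : npair (nfst z) (nsnd z) = z.
Proof.
unfold npair, nfst, nsnd. rewrite <- surjective_pairing. apply cancel_to_of.
Qed.

(** The model has no identity code; re-pairing the two projections supplies one. *)
Lemma computable_id : computable (fun _ x => x).
Proof.
apply (computable_ext (fun _ x => npair_nfst_nsnd x)), computable_npair.
- exists c_left. reflexivity.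
- exists c_right. reflexivity.
Qed.

(** [c_prec] is fed with the pair of [x] and the number of steps [G f x]. The arithmetic below is
    obtained by choosing the step [H]. *)
Lemma computable_rect (F G : Baire -> nat -> nat)
    (H : Baire -> nat -> nat -> nat -> nat) :
  computable F ->
  computable (fun f z => H f (nfst z) (nfst (nsnd z)) (nsnd (nsnd z))) ->
  computable G ->
  computable (fun f x => nat_rect (fun _ => nat) (F f x) (H f x) (G f x)).
Proof.
intros [a Ha] [b Hb] HG.
destruct (computable_npair computable_id HG) as [p Hp].
exists (c_comp (c_prec a b) p). intros f x. simpl.
eexists; split; [apply Hp|]. rewrite nfst_pair, nsnd_pair.
induction (G f x) as [|k IH]; simpl; [apply Ha|].
eexists; split; [apply IH|].
specialize (Hb f (npair x (npair k
  (nat_rect (fun _ => nat) (F f x) (H f x) k)))).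
now rewrite !nsnd_pair, !nfst_pair in Hb.
Qed.

Arguments computable_rect {F G} H.

Create HintDb comp.
Hint Resolve computable_id computable_zero computable_const computable_S
  computable_nfst computable_nsnd computable_oracle computable_npair : comp.

(** * Arithmetic on natural numbers *)

Lemma computable_add (F G : Baire -> nat -> nat) :
  computable F -> computable G -> computable (fun f x => F f x + G f x).
Proof.
intros HF HG.
refine (computable_ext _ (computable_rect (fun _ _ _ r => S r) HG _ HF));
  [|auto with comp].
intros f x; simpl. induction (F f x); simpl; congruence.
Qed.
Hint Resolve computable_add : comp.

Lemma computable_pred (F : Baire -> nat -> nat) :
  computable F -> computable (fun f x => pred (F f x)).
Proof.
intros HF.
refine (computable_ext _
  (computable_rect (fun _ _ k _ => k) computable_zero _ HF));
  [|auto with comp].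
intros f x; simpl. now destruct (F f x).
Qed.
Hint Resolve computable_pred : comp.

Lemma computable_sub (F G : Baire -> nat -> nat) :
  computable F -> computable G -> computable (fun f x => F f x - G f x).
Proof.
intros HF HG.
refine (computable_ext _ (computable_rect (fun _ _ _ r => pred r) HF _ HG));
  [|auto with comp].
intros f x; simpl. induction (G f x); simpl; lia.
Qed.
Hint Resolve computable_sub : comp.

Lemma computable_mul (F G : Baire -> nat -> nat) :
  computable F -> computable G -> computable (fun f x => F f x * G f x).
Proof.
intros HF HG.
refine (computable_ext _
  (computable_rect (fun f x _ r => G f x + r) computable_zero _ HF));
  [|apply computable_add; [apply (computable_comp HG)|]; auto with comp].
intros f x; simpl. induction (F f x); simpl; lia.
Qed.
Hint Resolve computable_mul : comp.

Lemma computable_pow2 (F : Baire -> nat -> nat) :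
  computable F -> computable (fun f x => 2 ^ F f x).
Proof.
intros HF.
refine (computable_ext _
  (computable_rect (fun _ _ _ r => r + r) (computable_const 1) _ HF));
  [|auto with comp].
intros f x; simpl. induction (F f x); simpl; lia.
Qed.
Hint Resolve computable_pow2 : comp.

Lemma computable_odd (F : Baire -> nat -> nat) :
  computable F -> computable (fun f x => Nat.b2n (Nat.odd (F f x))).
Proof.
intros HF.
refine (computable_ext _
  (computable_rect (fun _ _ _ r => 1 - r) computable_zero _ HF));
  [|auto with comp].
intros f x; simpl. induction (F f x) as [|n IH]; simpl; auto.
rewrite IH, Nat.odd_succ, <- Nat.negb_odd. now destruct (Nat.odd n).
Qed.

Lemma computable_div2 (F : Baire -> nat -> nat) :
  computable F -> computable (fun f x => Nat.div2 (F f x)).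
Proof.
intros HF.
refine (computable_ext _
  (computable_rect (fun _ _ k r => r + Nat.b2n (Nat.odd k)) computable_zero _ HF));
  [|apply computable_add; [|apply computable_odd]; auto with comp].
intros f x; simpl. induction (F f x) as [|n IH]; simpl nat_rect; auto.
rewrite IH. pose proof (Nat.div2_odd n). pose proof (Nat.div2_odd (S n)) as H1.
rewrite Nat.odd_succ, <- Nat.negb_odd in H1.
destruct (Nat.odd n); simpl Nat.b2n in *; lia.
Qed.
Hint Resolve computable_div2 : comp.

(** * Closure properties of decidable relations *)

Lemma dec_rel_lt (F G : Baire -> nat -> nat) :
  computable F -> computable G -> dec (fun f x => F f x < G f x).
Proof.
intros HF HG. exists (fun f x => S (F f x) - G f x).
split; [auto with comp | lia].
Qed.

Lemma dec_rel_eq (F G : Baire -> nat -> nat) :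
  computable F -> computable G -> dec (fun f x => F f x = G f x).
Proof.
intros HF HG. exists (fun f x => (F f x - G f x) + (G f x - F f x)).
split; [auto with comp | lia].
Qed.

Lemma dec_rel_and (P Q : Baire -> nat -> Prop) :
  dec P -> dec Q -> dec (fun f x => P f x /\ Q f x).
Proof.
intros [F [HF HP]] [G [HG HQ]]. exists (fun f x => F f x + G f x).
split; [auto with comp|]. intros f x. rewrite <- HP, <- HQ. lia.
Qed.

Lemma dec_rel_or (P Q : Baire -> nat -> Prop) :
  dec P -> dec Q -> dec (fun f x => P f x \/ Q f x).
Proof.
intros [F [HF HP]] [G [HG HQ]]. exists (fun f x => F f x * G f x).
split; [auto with comp|]. intros f x. rewrite <- HP, <- HQ. lia.
Qed.

Lemma dec_rel_not (P : Baire -> nat -> Prop) : dec P -> dec (fun f x => ~ P f x).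
Proof.
intros [F [HF HP]]. exists (fun f x => 1 - F f x).
split; [auto with comp|]. intros f x. rewrite <- HP. lia.
Qed.

(** With [0] as truth, a product of test values vanishes iff one of its factors does, so the
    quantifier becomes a product accumulated by recursion. *)
Lemma dec_bounded_ex (P : Baire -> nat -> nat -> Prop) (F : Baire -> nat -> nat) :
  dec (fun f z => P f (nfst z) (nsnd z)) -> computable F ->
  dec (fun f x => exists k, k < F f x /\ P f x k).
Proof.
intros [G [HG HP]] HF.
exists (fun f x => nat_rect (fun _ => nat) 1 (fun k r => G f (npair x k) * r) (F f x)).
split.
- apply (@computable_rect (fun _ _ => 1) F (fun f x k r => G f (npair x k) * r));
    auto with comp.
  apply computable_mul; [apply computable_comp|]; auto with comp.
- intros f x. induction (F f x) as [|n IH]; simpl.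
  + split; [discriminate | intros [k [Hk _]]; lia].
  + specialize (HP f (npair x n)). rewrite nfst_pair, nsnd_pair in HP.
    rewrite Nat.mul_eq_0, IH, HP. split.
    * intros [H|[k [Hk H]]]; [exists n | exists k]; split; auto.
    * intros [k [Hk H]]. destruct (Nat.eq_dec k n) as [->|]; auto.
      right. exists k. split; [lia | auto].
Qed.

Arguments dec_bounded_ex P {F}.

Lemma dec_bounded_all (P : Baire -> nat -> nat -> Prop) (F : Baire -> nat -> nat) :
  dec (fun f z => P f (nfst z) (nsnd z)) -> computable F ->
  dec (fun f x => forall k, k < F f x -> P f x k).
Proof.
intros HP HF.
eapply dec_rel_iff, dec_rel_not,
  (dec_bounded_ex (fun f x k => ~ P f x k) (dec_rel_not HP) HF).
intros f x; simpl; split.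
- intros H k Hk. apply NNPP. eauto.
- intros H [k [Hk Hn]]. auto.
Qed.

(** A binary digit is the parity of the index after repeated halving. *)
Lemma dec_in_Delta (F G : Baire -> nat -> nat) :
  computable F -> computable G -> dec (fun f x => in_Delta (F f x) (G f x)).
Proof.
intros HF HG.
exists (fun f x => 1 - Nat.b2n (Nat.odd (Nat.shiftr (F f x) (G f x)))). split.
- apply computable_sub; [auto with comp|]. apply computable_odd.
  apply (@computable_rect F G (fun _ _ _ r => Nat.div2 r)); auto with comp.
- intros f x. unfold in_Delta. rewrite Nat.testbit_odd.
  now destruct (Nat.odd _).
Qed.

(** A recursion of length [T f x]: zero steps give [F], any positive number gives [G]. As [d] is
    arbitrary, branching on [excluded_middle_informative] is covered. *)
Lemma computable_if (P : Baire -> nat -> Prop) (F G : Baire -> nat -> nat)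
    (d : forall f x, {P f x} + {~ P f x}) :
  dec P -> computable F -> computable G ->
  computable (fun f x => if d f x then F f x else G f x).
Proof.
intros [T [HT HP]] HF HG.
refine (computable_ext _ (computable_rect (fun f x _ _ => G f x) HF _ HT));
  [|apply (computable_comp HG); auto with comp].
intros f x; simpl. destruct (d f x) as [H|H]; rewrite <- HP in H.
- now rewrite H.
- now destruct (T f x).
Qed.

(** * Unbounded search *)

Lemma least_witness (P : nat -> Prop) :
  (exists n, P n) -> exists n, P n /\ forall i, i < n -> ~ P i.
Proof.
intros [n Hn]. induction n as [n IH] using lt_wf_ind.
destruct (classic (exists m, m < n /\ P m)) as [[m [Hm HPm]]|H]; eauto.
exists n. split; auto. intros i Hi HPi. eauto.
Qed.

(** [c_mu] finds the least witness and [H] post-processes it. Witnesses are required only for the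
    oracle at hand, so the code may diverge outside the domain of a reduction. *)
Lemma search (P : Baire -> nat -> nat -> Prop) (H : Baire -> nat -> nat) :
  dec (fun f z => P f (nfst z) (nsnd z)) -> computable H ->
  exists c, forall f, (forall n, exists y, P f n y) ->
    exists g, computes c f (fun n => H f (g n)) /\ forall n, P f n (g n).
Proof.
intros [F [[a Ha] HP]] [h Hh]. exists (c_comp h (c_mu a)). intros f Hf.
assert (HF : forall n y, F f (npair n y) = 0 <-> P f n y).
{ intros n y. now rewrite HP, nfst_pair, nsnd_pair. }
pose proof (fun n => least_witness (Hf n)) as Hl.
exists (fun n => proj1_sig (constructive_indefinite_description _ (Hl n))). split.
- intros n. destruct (constructive_indefinite_description _ _) as [y [Hy Hi]].
  simpl. exists y. split; auto. split.
  + rewrite <- (proj2 (HF n y) Hy). apply Ha.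
  + intros i Hlt. exists (pred (F f (npair n i))).
    replace (S (pred (F f (npair n i)))) with (F f (npair n i)); [apply Ha|].
    specialize (Hi i Hlt). rewrite <- HF in Hi. lia.
- intros n. destruct (constructive_indefinite_description _ _) as [y [Hy Hi]]. auto.
Qed.

(** * General facts on [eval] *)

Lemma eval_det (f : Baire) (c : code) : forall x y z,
  eval f c x y -> eval f c x z -> y = z.
Proof.
induction c as [| | | | |a IHa b IHb|a IHa b IHb|a IHa b IHb|a IHa];
  simpl; intros x y z Hy Hz; try congruence.
- destruct Hy as [u [v [Hu [Hv ->]]]], Hz as [u' [v' [Hu' [Hv' ->]]]].
  f_equal; eauto.
- destruct Hy as [u [Hu Hy]], Hz as [v [Hv Hz]].
  rewrite (IHb _ _ _ Hu Hv) in Hy. eauto.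
- revert y z Hy Hz. induction (nsnd x) as [|k IH]; simpl; eauto.
  intros y z [r [Hr Hy]] [s [Hs Hz]]. rewrite (IH _ _ Hr Hs) in Hy. eauto.
- destruct Hy as [Hy Hyi], Hz as [Hz Hzi].
  destruct (Nat.lt_total y z) as [H|[H|H]]; auto.
  + destruct (Hzi _ H) as [r Hr]. discriminate (IHa _ _ _ Hy Hr).
  + destruct (Hyi _ H) as [r Hr]. discriminate (IHa _ _ _ Hz Hr).
Qed.

(** The use principle: a halting computation reads only finitely many oracle values. *)
Lemma eval_use (f : Baire) (c : code) : forall x y, eval f c x y ->
  exists N, forall g, (forall i, i < N -> g i = f i) -> eval g c x y.
Proof.
induction c as [| | | | |a IHa b IHb|a IHa b IHb|a IHa b IHb|a IHa];
  simpl; intros x y Hy; try (exists 0; now intros).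
- exists (S x). intros g Hg. rewrite Hg; auto.
- destruct Hy as [u [v [Hu [Hv ->]]]].
  destruct (IHa _ _ Hu) as [N HN], (IHb _ _ Hv) as [N' HN'].
  exists (N + N'). intros g Hg. exists u, v. split; [|split]; auto.
  + apply HN. intros; apply Hg; lia.
  + apply HN'. intros; apply Hg; lia.
- destruct Hy as [u [Hu Hy]].
  destruct (IHb _ _ Hu) as [N HN], (IHa _ _ Hy) as [N' HN'].
  exists (N + N'). intros g Hg. exists u. split.
  + apply HN. intros; apply Hg; lia.
  + apply HN'. intros; apply Hg; lia.
- revert y Hy. induction (nsnd x) as [|k IH]; simpl; auto.
  intros y [r [Hr Hy]].
  destruct (IH _ Hr) as [N HN], (IHb _ _ Hy) as [N' HN'].
  exists (N + N'). intros g Hg. exists r. split.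
  + apply HN. intros; apply Hg; lia.
  + apply HN'. intros; apply Hg; lia.
- destruct Hy as [Hy Hi]. destruct (IHa _ _ Hy) as [N HN].
  (* The bounds for the failed tests of [c_mu] are accumulated one test at a time. *)
  assert (H : forall j, j <= y -> exists M, forall g, (forall i, i < M -> g i = f i) ->
            forall i, i < j -> exists r, eval g a (npair x i) (S r)).
  { induction j as [|j IH]; intros Hj.
    - exists 0. intros; lia.
    - destruct IH as [M HM]; [lia|]. destruct (Hi j) as [r Hr]; [lia|].
      destruct (IHa _ _ Hr) as [M' HM'].
      exists (M + M'). intros g Hg i Hij. destruct (Nat.eq_dec i j) as [->|].
      + exists r. apply HM'. intros; apply Hg; lia.
      + apply HM; [|lia]. intros; apply Hg; lia. }
  destruct (H y (le_n _)) as [M HM].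
  exists (N + M). intros g Hg. split.
  + apply HN. intros; apply Hg; lia.
  + apply HM. intros; apply Hg; lia.
Qed.

(** [eval0] runs with the constant oracle [0], so putting [c_zero] for [c_oracle] keeps its results
    under any oracle. This carries the distance algorithm into a reduction. *)
Fixpoint without_oracle (c : code) : code :=
  match c with
  | c_oracle => c_zero
  | c_pair a b => c_pair (without_oracle a) (without_oracle b)
  | c_comp a b => c_comp (without_oracle a) (without_oracle b)
  | c_prec a b => c_prec (without_oracle a) (without_oracle b)
  | c_mu a => c_mu (without_oracle a)
  | _ => c
  end.

Lemma eval_without_oracle (f : Baire) (c : code) : forall x y,
  eval0 c x y -> eval f (without_oracle c) x y.
Proof.
unfold eval0.
induction c as [| | | | |a IHa b IHb|a IHa b IHb|a IHa b IHb|a IHa];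
  simpl; intros x y Hy; auto.
- destruct Hy as [u [v [Hu [Hv ->]]]]. exists u, v. auto.
- destruct Hy as [u [Hu Hy]]. eauto.
- revert y Hy. induction (nsnd x) as [|k IH]; simpl; auto.
  intros y [r [Hr Hy]]. eauto.
- destruct Hy as [Hy Hi]. split; auto. intros i Hlt.
  destruct (Hi i Hlt) as [r Hr]. eauto.
Qed.

(** * Comparison of coded rationals *)

Lemma Q2R_c_Q (n : nat) :
  Q2R (c_Q n) =
  ((INR (nfst n) - INR (nfst (nsnd n))) / INR (S (nsnd (nsnd n))))%R.
Proof.
unfold c_Q, Q2R, Rdiv. simpl Qnum. simpl Qden.
rewrite minus_IZR, <- !INR_IZR_INZ. do 2 f_equal. now rewrite INR_IZR_INZ.
Qed.

Definition rat (i j k : nat) : nat := npair i (npair j k).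

Lemma Q2R_rat (i j k : nat) :
  Q2R (c_Q (rat i j k)) = ((INR i - INR j) / INR (S k))%R.
Proof.
unfold rat. now rewrite Q2R_c_Q, !nsnd_pair, !nfst_pair.
Qed.

Lemma computable_rat (F G H : Baire -> nat -> nat) :
  computable F -> computable G -> computable H ->
  computable (fun f x => rat (F f x) (G f x) (H f x)).
Proof.
unfold rat. auto with comp.
Qed.
Hint Resolve computable_rat : comp.

Lemma INR_pow2 (k : nat) : INR (2 ^ k) = (2 ^ k)%R.
Proof.
now rewrite pow_INR.
Qed.

Lemma pow2_pos (k : nat) : 0 < 2 ^ k.
Proof.
apply Nat.neq_0_lt_0, Nat.pow_nonzero. discriminate.
Qed.

(** The [pred] offsets the shift by one in the denominators of [c_Q]. *)
Lemma Q2R_rat_pow2 (i k : nat) :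
  Q2R (c_Q (rat i 0 (pred (2 ^ k)))) = (INR i * (/ 2) ^ k)%R.
Proof.
pose proof (pow2_pos k).
rewrite Q2R_rat, Nat.succ_pred by lia. rewrite INR_pow2, pow_inv.
simpl. unfold Rdiv. now rewrite Rminus_0_r.
Qed.

Lemma half_pow_pos (k : nat) : (0 < (/ 2) ^ k)%R.
Proof.
apply pow_lt. lra.
Qed.

Lemma half_pow_small (eps : R) :
  (0 < eps)%R -> exists N, forall n, N <= n -> ((/ 2) ^ n < eps)%R.
Proof.
intros H. destruct (pow_lt_1_zero (/ 2)) with (y := eps) as [N HN]; auto.
{ rewrite Rabs_pos_eq; lra. }
exists N. intros n Hn. specialize (HN n Hn).
rewrite Rabs_pos_eq in HN; auto. apply Rlt_le, half_pow_pos.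
Qed.

Lemma half_pow_mono (i j : nat) : i <= j -> ((/ 2) ^ j <= (/ 2) ^ i)%R.
Proof.
intros H. rewrite !pow_inv. apply Rinv_le_contravar; [apply pow_lt; lra|].
apply Rle_pow; [lra|lia].
Qed.

Lemma dec_Q2R_lt (F G H : Baire -> nat -> nat) (j : nat) :
  computable F -> computable G -> computable H ->
  dec (fun f x =>
    Q2R (c_Q (F f x)) + INR j * (/ 2) ^ H f x < Q2R (c_Q (G f x)))%R.
Proof.
intros HF HG HH.
(* Both sides are multiplied by all three denominators, and the subtractions
   hidden in [c_Q] are moved across the inequality. *)
apply dec_rel_iff with (P := fun f x =>
  nfst (F f x) * S (nsnd (nsnd (G f x))) * 2 ^ H f x
  + j * S (nsnd (nsnd (F f x))) * S (nsnd (nsnd (G f x)))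
  + nfst (nsnd (G f x)) * S (nsnd (nsnd (F f x))) * 2 ^ H f x
  < nfst (G f x) * S (nsnd (nsnd (F f x))) * 2 ^ H f x
    + nfst (nsnd (F f x)) * S (nsnd (nsnd (G f x))) * 2 ^ H f x).
- intros f x. rewrite !Q2R_c_Q, pow_inv.
  generalize (nfst (F f x)) (nfst (nsnd (F f x))) (nsnd (nsnd (F f x)))
    (nfst (G f x)) (nfst (nsnd (G f x))) (nsnd (nsnd (G f x))) (H f x).
  intros a b c a' b' c' k.
  assert (Hc := lt_0_INR (S c) (Nat.lt_0_succ c)).
  assert (Hc' := lt_0_INR (S c') (Nat.lt_0_succ c')).
  assert (Hk := pow_lt 2 k ltac:(lra)).
  set (u := INR (S c)) in *. set (v := INR (S c')) in *. set (w := (2 ^ k)%R) in *.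
  transitivity (INR a * v * w + INR j * u * v + INR b' * u * w
                < INR a' * u * w + INR b * v * w)%R.
  + unfold u, v, w. rewrite <- INR_pow2, <- !mult_INR, <- !plus_INR.
    split; [apply lt_INR | apply INR_lt].
  + assert (Hp : (0 < u * v * w)%R) by now repeat apply Rmult_lt_0_compat.
    assert (E : ((INR a' - INR b') / v - ((INR a - INR b) / u + INR j * / w)
      = (INR a' * u * w + INR b * v * w
         - (INR a * v * w + INR j * u * v + INR b' * u * w)) / (u * v * w))%R)
      by (field; lra).
    etransitivity; [|apply Rlt_0_minus]. rewrite E.
    split; intros Hlt.
    * apply Rlt_0_minus in Hlt. now apply Rdiv_lt_0_compat.
    * apply Rlt_0_minus. apply Rmult_lt_reg_r with (/ (u * v * w))%R;
        [now apply Rinv_0_lt_compat | now rewrite Rmult_0_l].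
- apply dec_rel_lt; auto 20 with comp.
Qed.

Lemma dec_radius_lt (F H : Baire -> nat -> nat) :
  computable F -> computable H ->
  dec (fun f x => radius (F f x) < (/ 2) ^ H f x)%R.
Proof.
intros HF HH.
apply dec_rel_iff with (P := fun f x =>
  (Q2R (c_Q (nsnd (F f x))) + INR 0 * (/ 2) ^ H f x
   < Q2R (c_Q (rat 1 0 (pred (2 ^ H f x)))))%R).
- intros f x. unfold radius. rewrite Q2R_rat_pow2. simpl (INR _).
  now rewrite Rmult_0_l, Rplus_0_r, Rmult_1_l.
- apply dec_Q2R_lt; auto with comp.
Qed.

(** * The reductions *)

Lemma rep_le_computable (X : Type) (rho1 rho2 : multirep X)
    (F : Baire -> nat -> nat) :
  computable F -> (forall f x, rho1 f x -> rho2 (F f) x) -> rep_le rho1 rho2.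
Proof.
intros [c Hc] H. exists c. intros f _. exists (F f). split; auto.
intros n. apply Hc.
Qed.

Lemma in_Delta_lt (e k : nat) : in_Delta e k -> k < e.
Proof.
intros H. destruct (Nat.lt_ge_cases k e) as [|Hle]; auto.
unfold in_Delta in H. destruct (Nat.eq_dec e 0) as [->|He].
- now rewrite Nat.bits_0 in H.
- rewrite Nat.bits_above_log2 in H; [discriminate|].
  pose proof (Nat.log2_lt_lin e). lia.
Qed.

Lemma in_Delta_pow2 (b k : nat) : in_Delta (2 ^ b) k <-> k = b.
Proof.
unfold in_Delta. rewrite Nat.pow2_bits_eqb, Nat.eqb_eq. split; auto.
Qed.

Section Reductions.

Variable M : nes_metric_space.
Local Notation d := (dist (space M)).
Local Open Scope R_scope.

(** The Cauchy bound passes to the limit, where the strict inequality becomes a non-strict one. *)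
Lemma Cau_names_close (p : Baire) (x : point M) :
  Cau_names M p x ->
  forall i, exists a, nu M (p i) = Some a /\ d a x <= (/ 2) ^ i.
Proof.
intros [s [Hs [Hc Hx]]] i. exists (s i). split; auto.
apply le_epsilon. intros eps Heps. destruct (Hx eps Heps) as [N HN].
set (n := (S (N + i))%nat).
specialize (HN n ltac:(unfold n; lia)). unfold Rdist in HN.
rewrite Rminus_0_r in HN. pose proof (Rle_abs (d (s n) x)).
specialize (Hc n i ltac:(unfold n; lia)). rewrite dist_sym in Hc.
pose proof (dist_tri (space M) (s i) x (s n)). lra.
Qed.

(** By the triangle inequality through [x], entries [j < i] differ by less than
    [((/ 2) ^ i + (/ 2) ^ j) / 4], which is below [(/ 2) ^ j]. *)
Lemma Cau_names_intro (p : Baire) (x : point M) :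
  (forall i, exists a, nu M (p i) = Some a /\ d a x < (/ 2) ^ (i + 2)) ->
  Cau_names M p x.
Proof.
intros H.
set (s := fun i => proj1_sig (constructive_indefinite_description _ (H i))).
assert (Hs : forall i, nu M (p i) = Some (s i) /\ d (s i) x < (/ 2) ^ (i + 2)).
{ intros i. exact (proj2_sig (constructive_indefinite_description _ (H i))). }
assert (Hq : forall i, (/ 2) ^ (i + 2) = (/ 2) ^ i / 4).
{ intros i. rewrite pow_add. simpl. field. }
exists s. repeat split.
- intros i. apply Hs.
- intros i j Hij. pose proof (proj2 (Hs i)) as Hi. pose proof (proj2 (Hs j)) as Hj.
  rewrite Hq in Hi, Hj. rewrite dist_sym in Hj.
  pose proof (half_pow_mono (Nat.lt_le_incl _ _ Hij)).
  pose proof (half_pow_pos j).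
  pose proof (dist_tri (space M) (s i) (s j) x). lra.
- intros eps Heps. destruct (half_pow_small Heps) as [N HN].
  exists N. intros n Hn. unfold Rdist. rewrite Rminus_0_r, Rabs_pos_eq.
  + eapply Rlt_trans; [apply Hs|]. apply HN. lia.
  + apply Rge_le, dist_pos.
Qed.

(** A common form of neighbourhood basis, from which names for [rho_min] and [rho_incl] are both
    read off. The factor [2] accommodates the balls built from Cauchy names. *)
Definition shrinking_balls (g : Baire) (x : point M) : Prop :=
  forall i, ball_dom M (g i) /\ ball M (g i) x /\ radius (g i) <= 2 * (/ 2) ^ i.

Lemma ball_dom_of_mem (b : nat) (x : point M) : ball M b x -> ball_dom M b.
Proof.
intros [a [Ha Hax]]. split; [eauto|].
pose proof (dist_pos (space M) a x). lra.
Qed.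

Lemma shrinking_balls_min (g : Baire) (x : point M) :
  shrinking_balls g x -> min_names (ball_dom M) (ball M) g x.
Proof.
intros Hg. split; [intros n; split; apply Hg|].
intros b _ [a [Ha Hax]].
(* Two points of a ball of radius at most [2 * (/ 2) ^ n] are less than [4 * (/ 2) ^ n] apart. *)
destruct (@half_pow_small ((radius b - d a x) / 4) ltac:(lra)) as [n Hn].
specialize (Hn n (le_n n)).
exists (n :: nil). intros y Hy. specialize (Hy n (or_introl eq_refl)).
destruct Hy as [a' [Ha' Hy]], (Hg n) as [_ [[a'' [Ha'' Hx]] Hr]].
assert (a'' = a') by congruence. subst a''.
exists a. split; auto. rewrite dist_sym in Hx.
pose proof (dist_tri (space M) a y x). pose proof (dist_tri (space M) x y a').
lra.
Qed.

Lemma shrinking_balls_incl (g : Baire) (x : point M) :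
  shrinking_balls g x ->
  incl_names (ball_dom M) (ball M) (ball_incl M) (fun n => 2 ^ g n)%nat x.
Proof.
intros Hg. split.
- intros n. split; intros k Hk; apply in_Delta_pow2 in Hk; subst k; apply Hg.
(* [eps] is a slack common to all balls indexed by the finite set, so one small ball is strongly
   included in each of them. *)
- intros e _ He. destruct (hat_room e He) as [eps [Heps Hroom]].
  destruct (@half_pow_small (eps / 4) ltac:(lra)) as [n Hn].
  specialize (Hn n (le_n n)). exists n. intros k Hk. exists (g n).
  split; [now apply in_Delta_pow2|].
  destruct (Hroom k (in_Delta_lt Hk) Hk) as [a2 [Ha2 Hd2]].
  destruct (Hg n) as [_ [[a1 [Ha1 Hd1]] Hr]].
  exists a1, a2. repeat split; auto. rewrite dist_sym in Hd2.
  pose proof (dist_tri (space M) a1 a2 x). lra.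
Qed.

(** The limit is known to be within [(/ 2) ^ i] only non-strictly; doubling the radius puts it
    inside the open ball. *)
Definition wide_ball (a i : nat) : nat := npair a (rat 2 0 (pred (2 ^ i))).

Lemma computable_wide_ball (F G : Baire -> nat -> nat) :
  computable F -> computable G ->
  computable (fun f x => wide_ball (F f x) (G f x)).
Proof.
unfold wide_ball. auto 10 with comp.
Qed.

Lemma radius_wide_ball (a i : nat) : radius (wide_ball a i) = 2 * (/ 2) ^ i.
Proof.
unfold radius, wide_ball. now rewrite nsnd_pair, Q2R_rat_pow2.
Qed.

Lemma Cau_names_wide_balls (p : Baire) (x : point M) :
  Cau_names M p x -> shrinking_balls (fun i => wide_ball (p i) i) x.
Proof.
intros Hp i. destruct (Cau_names_close Hp i) as [a [Ha Hax]].
pose proof (half_pow_pos i).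
assert (Hb : ball M (wide_ball (p i) i) x).
{ exists a. rewrite radius_wide_ball. unfold wide_ball. rewrite nfst_pair.
  split; auto. lra. }
split; [exact (ball_dom_of_mem Hb)|]. split; auto.
rewrite radius_wide_ball. lra.
Qed.

Lemma Cau_le_incl : rep_le (rho_Cau M) (rho_incl M).
Proof.
apply rep_le_computable with (F := fun p i => (2 ^ wide_ball (p i) i)%nat).
- apply computable_pow2, computable_wide_ball; auto with comp.
- intros p x Hp. exact (shrinking_balls_incl (Cau_names_wide_balls Hp)).
Qed.

Lemma max_le_Cau : rep_le (rho_max M) (rho_Cau M).
Proof.
destruct (@search (fun f i y => radius (f y) < (/ 2) ^ (i + 2))
  (fun f y => nfst (f y))) as [c Hc].
{ apply dec_radius_lt; auto with comp. }
{ auto with comp. }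
(* [x0] makes the search halt; the balls found contain every point named by [f]. *)
exists c. intros f [x0 Hx0]. destruct (Hc f) as [g [Hg Hr]].
- intros i. destruct (@small_ball M x0 ((/ 2) ^ (i + 2)) (half_pow_pos _))
    as [b [Hd [Hb Hr]]].
  destruct (proj2 (Hx0 b) (conj Hd Hb)) as [y <-]. now exists y.
- eexists. split; [exact Hg|]. intros x Hx. apply Cau_names_intro. intros i.
  destruct (proj1 (Hx (f (g i))) (ex_intro _ _ eq_refl)) as [_ [a [Ha Hax]]].
  exists a. split; auto. specialize (Hr i). simpl in Hr. lra.
Qed.

(** The defining property of the name is applied to the singleton [2 ^ b] of a small ball [b].
    Distances being nonnegative, strong inclusion forces a smaller radius. *)
Lemma incl_names_small (f : Baire) (x : point M) (i : nat) :
  incl_names (ball_dom M) (ball M) (ball_incl M) f x ->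
  exists n k, in_Delta (f n) k /\ radius k < (/ 2) ^ i.
Proof.
intros [_ H].
destruct (@small_ball M x ((/ 2) ^ i) (half_pow_pos _)) as [b [Hd [Hb Hr]]].
destruct (H (2 ^ b)%nat) as [n Hn].
- intros k Hk. apply in_Delta_pow2 in Hk. now subst.
- intros k Hk. apply in_Delta_pow2 in Hk. now subst.
- destruct (Hn b (proj2 (in_Delta_pow2 b b) eq_refl))
    as [k [Hk [a1 [a2 [_ [_ Hlt]]]]]].
  exists n, k. split; auto. pose proof (dist_pos (space M) a1 a2). lra.
Qed.

(** [H] selects the output: the centre for [rho_Cau], the ball itself for [rho_min]. A search value
    pairs a position in the name with an element of the finite set found there. *)
Lemma incl_search (H : Baire -> nat -> nat) : computable H ->
  exists c, forall f, rep_dom (rho_incl M) f ->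
    exists g, computes c f (fun i => H f (g i)) /\
      forall x, rho_incl M f x ->
      forall i, ball M (g i) x /\ radius (g i) < (/ 2) ^ (i + 2).
Proof.
intros HH.
destruct (@search (fun f i y => in_Delta (f (nfst y)) (nsnd y) /\
    radius (nsnd y) < (/ 2) ^ (i + 2)) (fun f y => H f (nsnd y))) as [c Hc].
{ apply dec_rel_and; [apply dec_in_Delta | apply dec_radius_lt]; auto with comp. }
{ apply (computable_comp HH). auto with comp. }
exists c. intros f [x0 Hx0]. destruct (Hc f) as [g [Hg Hr]].
- intros i. destruct (incl_names_small (i + 2) Hx0) as [n [k Hk]].
  exists (npair n k). now rewrite nfst_pair, nsnd_pair.
- exists (fun i => nsnd (g i)). split; [exact Hg|].
  intros x [Hx _] i. destruct (Hr i) as [Hi Hri]. split; auto.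
  now apply (Hx (nfst (g i))).
Qed.

Lemma incl_le_Cau : rep_le (rho_incl M) (rho_Cau M).
Proof.
destruct (@incl_search (fun _ b => nfst b)) as [c Hc]; [auto with comp|].
exists c. intros f Hf. destruct (Hc f Hf) as [g [Hg Hb]].
eexists. split; [exact Hg|]. intros x Hx. apply Cau_names_intro. intros i.
destruct (Hb x Hx i) as [[a [Ha Hax]] Hr]. exists a. split; auto. lra.
Qed.

Lemma incl_le_min : rep_le (rho_incl M) (rho_min M).
Proof.
destruct (@incl_search (fun _ b => b)) as [c Hc]; [auto with comp|].
exists c. intros f Hf. destruct (Hc f Hf) as [g [Hg Hb]].
exists g. split; [exact Hg|]. intros x Hx. apply shrinking_balls_min. intros i.
destruct (Hb x Hx i) as [Hi Hr]. split; [exact (ball_dom_of_mem Hi)|].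
split; auto. pose proof (half_pow_pos i).
assert (Hle : (i <= i + 2)%nat) by lia. pose proof (half_pow_mono Hle). lra.
Qed.

End Reductions.

(** * Computable distances for a total numbering *)

Lemma Rabs_le_between (x e : R) : (Rabs x <= e -> - e <= x <= e)%R.
Proof.
intros H. pose proof (Rle_abs x). pose proof (Rle_abs (- x)) as Hn.
rewrite Rabs_Ropp in Hn. lra.
Qed.

(** Totality of [nu] makes the algorithm halt on every input, which yields a total function to which
    the decidability lemmas apply. *)
Lemma computable_dist (M : computable_metric_space) :
  exists D : nat -> nat,
    computable (fun _ x => D x) /\
    forall n m k a b, nu M n = Some a -> nu M m = Some b ->
      (Rabs (Q2R (c_Q (D (npair n (npair m k)))) - dist (space M) a b)
       <= (/ 2) ^ k)%R.
Proof.
destruct (dist_computable M) as [c Hc].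
assert (H : forall x, exists q, eval0 c x q /\
  forall a b, nu M (nfst x) = Some a -> nu M (nfst (nsnd x)) = Some b ->
  (Rabs (Q2R (c_Q q) - dist (space M) a b) <= (/ 2) ^ nsnd (nsnd x))%R).
{ intros x.
  destruct (nu_total M (nfst x)) as [a Ha].
  destruct (nu_total M (nfst (nsnd x))) as [b Hb].
  destruct (Hc _ _ (nsnd (nsnd x)) a b Ha Hb) as [q [Hq Hd]].
  rewrite !npair_nfst_nsnd in Hq.
  exists q. split; auto. intros a' b' Ha' Hb'.
  replace a' with a by congruence. now replace b' with b by congruence. }
exists (fun x => proj1_sig (constructive_indefinite_description _ (H x))). split.
- exists (without_oracle c). intros f x. apply eval_without_oracle.
  exact (proj1 (proj2_sig (constructive_indefinite_description _ (H x)))).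
- intros n m k a b Ha Hb.
  destruct (constructive_indefinite_description _ _) as [q [Hq Hd]]. simpl.
  rewrite !nsnd_pair, !nfst_pair in Hd. auto.
Qed.

Lemma Cau_le_max (M : computable_metric_space) :
  rep_le (rho_Cau M) (rho_max M).
Proof.
destruct (computable_dist M) as [D [HD HDd]].
(* [t] codes a ball and a precision. [D] and the entry of [p] each contribute an error of at most
   [(/ 2) ^ nsnd t], so the margin [3] makes the test sound. *)
set (near := fun (p : Baire) t =>
  (Q2R (c_Q (D (npair (nfst (nfst t)) (npair (p (nsnd t)) (nsnd t)))))
   + INR 3 * (/ 2) ^ nsnd t < Q2R (c_Q (nsnd (nfst t))))%R).
(* Every position must list a ball containing the point; the default is such a ball. *)
apply rep_le_computable with (F := fun p t =>
  if excluded_middle_informative (near p t) then nfst t else wide_ball (p 0) 0).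
- apply (@computable_if near); auto with comp.
  + apply dec_Q2R_lt; auto with comp. apply (computable_comp HD); auto 10 with comp.
  + apply computable_wide_ball; auto with comp.
- intros p x Hp b. simpl in Hp.
  assert (H3 : INR 3 = 3%R) by (simpl; lra).
  split.
  + intros [t <-]. destruct (excluded_middle_informative (near p t)) as [Ht|Ht].
    * assert (Hb : ball M (nfst t) x).
      { destruct (Cau_names_close Hp (nsnd t)) as [s [Hs Hsx]].
        destruct (nu_total M (nfst (nfst t))) as [a Ha].
        exists a. split; auto. unfold near in Ht. rewrite H3 in Ht.
        specialize (HDd _ _ (nsnd t) a s Ha Hs). unfold radius.
        apply Rabs_le_between in HDd.
        pose proof (dist_tri (space M) a x s). lra. }
      split; auto. exact (ball_dom_of_mem Hb).
    * destruct (Cau_names_wide_balls Hp 0) as [Hd [Hb _]]. auto.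
  + intros [_ [a [Ha Hax]]].
    (* The [5] is the margin [3] plus the two errors. *)
    destruct (@half_pow_small ((radius b - dist (space M) a x) / 5) ltac:(lra))
      as [k Hk].
    specialize (Hk k (le_n k)). exists (npair b k).
    destruct (excluded_middle_informative _) as [Ht|Ht]; [now rewrite nfst_pair|].
    exfalso. apply Ht. unfold near. rewrite H3, nfst_pair, nsnd_pair.
    destruct (Cau_names_close Hp k) as [s [Hs Hsx]].
    specialize (HDd _ _ k a s Ha Hs). apply Rabs_le_between in HDd.
    unfold radius in Hk. rewrite dist_sym in Hsx.
    pose proof (dist_tri (space M) a s x). lra.
Qed.

(** * A decidable halting predicate *)

Fixpoint enc (c : code) : nat :=
  match c with
  | c_zero => npair 0 0
  | c_succ => npair 1 0
  | c_left => npair 2 0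
  | c_right => npair 3 0
  | c_oracle => npair 4 0
  | c_pair a b => npair 5 (npair (enc a) (enc b))
  | c_comp a b => npair 6 (npair (enc a) (enc b))
  | c_prec a b => npair 7 (npair (enc a) (enc b))
  | c_mu a => npair 8 (npair (enc a) 0)
  end.

Lemma npair_inj (m n m' n' : nat) : npair m n = npair m' n' -> m = m' /\ n = n'.
Proof.
intros H. split.
- rewrite <- (nfst_pair m n), H. apply nfst_pair.
- rewrite <- (nsnd_pair m n), H. apply nsnd_pair.
Qed.

Lemma enc_inj (c c' : code) : enc c = enc c' -> c = c'.
Proof.
revert c'. induction c; intros [] H; simpl in H; apply npair_inj in H;
  destruct H as [H1 H2]; try discriminate; try reflexivity;
  apply npair_inj in H2; destruct H2; f_equal; auto.
Qed.

(** A finite set [s] of triples [(e, x, y)], each claiming that the code [e] maps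
    [x] to [y]. *)
Definition claim (s e x y : nat) : Prop := in_Delta s (npair e (npair x y)).

(** The triple [(e, x, y)] follows in one step of the definition of [eval], for
    the constant oracle [o], from triples of [s]. *)
Definition step (o s e x y : nat) : Prop :=
  let a := nfst (nsnd e) in
  let b := nsnd (nsnd e) in
  nfst e = 0 /\ y = 0 \/
  nfst e = 1 /\ y = S x \/
  nfst e = 2 /\ y = nfst x \/
  nfst e = 3 /\ y = nsnd x \/
  nfst e = 4 /\ y = o \/
  nfst e = 5 /\ (exists u, claim s a x u /\
                 exists v, claim s b x v /\ y = npair u v) \/
  nfst e = 6 /\ (exists u, claim s b x u /\ claim s a u y) \/
  nfst e = 7 /\ (nsnd x = 0 /\ claim s a (nfst x) y \/
    ~ nsnd x = 0 /\ exists r, claim s e (npair (nfst x) (pred (nsnd x))) r /\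
      claim s b (npair (nfst x) (npair (pred (nsnd x)) r)) y) \/
  nfst e = 8 /\ claim s a (npair x y) 0 /\
    forall i, i < y -> exists r, claim s a (npair x i) (S r).

(** No well-foundedness is asked for: every premise of a step is about a smaller
    code, or about the same code and a smaller recursion argument. *)
Definition justified (o s : nat) : Prop :=
  forall w, in_Delta s w -> step o s (nfst w) (nfst (nsnd w)) (nsnd (nsnd w)).

Lemma justified_claim (o s e x y : nat) :
  justified o s -> claim s e x y -> step o s e x y.
Proof.
intros H Hc. apply H in Hc. now rewrite !nsnd_pair, !nfst_pair in Hc.
Qed.

Lemma justified_sound (o s : nat) : justified o s ->
  forall c x y, claim s (enc c) x y -> eval (fun _ => o) c x y.
Proof.
intros Hs.
induction c as [| | | | |a IHa b IHb|a IHa b IHb|a IHa b IHb|a IHa];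
  intros x y Hc; pose proof (justified_claim Hs Hc) as H; unfold step in H;
  cbn [enc] in H; rewrite ?nsnd_pair, ?nfst_pair in H;
  (* Only the clause whose tag matches the head constructor survives. *)
  repeat (destruct H as [[Ht H]|H]; [try discriminate|]);
  try (destruct H; discriminate); auto.
- destruct H as [u [Hu [v [Hv ->]]]]. exists u, v. auto.
- destruct H as [u [Hu H]]. exists u. auto.
(* A [c_prec] step may appeal to the same code, whence an inner induction on the recursion
   argument. *)
- clear H Ht. simpl. remember (nsnd x) as k eqn:Hk.
  revert x y Hk Hc. induction k as [|k IH]; intros x y Hk Hc;
    pose proof (justified_claim Hs Hc) as H; unfold step in H;
    cbn [enc] in H; rewrite ?nsnd_pair, ?nfst_pair in H;
    repeat (destruct H as [[Ht H]|H]; [try discriminate|]);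
    try (destruct H; discriminate).
  + destruct H as [[_ H]|[H _]]; [now apply IHa | congruence].
  + destruct H as [[H _]|[_ [r [Hr H]]]]; [congruence|].
    rewrite <- Hk in Hr, H. simpl pred in Hr, H.
    simpl. exists r. split; auto.
    apply IH in Hr; [|now rewrite nsnd_pair]. now rewrite nfst_pair in Hr.
- destruct H as [_ [H Hi]]. split; auto.
  intros i Hlt. destruct (Hi i Hlt) as [r Hr]. eauto.
Qed.

Lemma step_mono (o s s' e x y : nat) :
  (forall k, in_Delta s k -> in_Delta s' k) -> step o s e x y -> step o s' e x y.
Proof.
intros Hs. unfold step, claim. intros H.
repeat (destruct H as [H|H]; [tauto|]).
destruct H as [[Ht [u [Hu [v [Hv Hy]]]]]|H]; [eauto 20|].
destruct H as [[Ht [u [Hu H]]]|H]; [eauto 20|].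
destruct H as [[Ht [[Hx H]|[Hx [r [Hr H]]]]]|[Ht [H Hi]]].
- do 7 right. left. auto.
- do 7 right. left. split; auto. right. split; auto. exists r. auto.
- do 8 right. repeat split; auto. intros i Hlt. destruct (Hi i Hlt). eauto.
Qed.

Lemma in_Delta_lor (s t k : nat) :
  in_Delta (Nat.lor s t) k <-> in_Delta s k \/ in_Delta t k.
Proof.
unfold in_Delta. now rewrite Nat.lor_spec, Bool.orb_true_iff.
Qed.

(** Steps are monotone in the set of premises, so witnesses for subcomputations can be merged by
    union. *)
Lemma justified_lor (o s t : nat) :
  justified o s -> justified o t -> justified o (Nat.lor s t).
Proof.
intros Hs Ht w Hw. apply in_Delta_lor in Hw. destruct Hw as [Hw|Hw].
- apply (step_mono (s := s)); auto. intros. apply in_Delta_lor. auto.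
- apply (step_mono (s := t)); auto. intros. apply in_Delta_lor. auto.
Qed.

Lemma justified_step (o s e x y : nat) :
  justified o s -> step o s e x y ->
  exists s', justified o s' /\ claim s' e x y.
Proof.
intros Hs H. exists (Nat.lor s (2 ^ npair e (npair x y))).
assert (Hsub : forall k, in_Delta s k ->
  in_Delta (Nat.lor s (2 ^ npair e (npair x y))) k).
{ intros. apply in_Delta_lor. auto. }
split.
- intros w Hw. apply in_Delta_lor in Hw. rewrite in_Delta_pow2 in Hw.
  apply (step_mono Hsub). destruct Hw as [Hw| ->]; auto.
  now rewrite !nsnd_pair, !nfst_pair.
- apply in_Delta_lor. rewrite in_Delta_pow2. auto.
Qed.

Lemma justified_zero (o : nat) : justified o 0.
Proof.
intros w Hw. unfold in_Delta in Hw. now rewrite Nat.bits_0 in Hw.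
Qed.

Lemma claim_lor_l (s t e x y : nat) : claim s e x y -> claim (Nat.lor s t) e x y.
Proof.
intros. apply in_Delta_lor. auto.
Qed.

Lemma claim_lor_r (s t e x y : nat) : claim t e x y -> claim (Nat.lor s t) e x y.
Proof.
intros. apply in_Delta_lor. auto.
Qed.

Hint Resolve justified_lor justified_zero claim_lor_l claim_lor_r : claims.

Lemma justified_complete (o : nat) (c : code) : forall x y,
  eval (fun _ => o) c x y -> exists s, justified o s /\ claim s (enc c) x y.
Proof.
induction c as [| | | | |a IHa b IHb|a IHa b IHb|a IHa b IHb|a IHa];
  intros x y H;
  try (apply (justified_step (s := 0)); [apply justified_zero|]; unfold step;
       cbn [enc]; rewrite nfst_pair; simpl in H; auto 20; fail).
- destruct H as [u [v [Hu [Hv ->]]]].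
  destruct (IHa _ _ Hu) as [s [Hs Hsu]], (IHb _ _ Hv) as [t [Ht Htv]].
  apply (justified_step (s := Nat.lor s t)); [auto with claims|].
  unfold step. cbn [enc]. rewrite !nsnd_pair, !nfst_pair.
  do 5 right. left. split; auto.
  exists u. split; [auto with claims|]. exists v. auto with claims.
- destruct H as [u [Hu Hy]].
  destruct (IHb _ _ Hu) as [s [Hs Hsu]], (IHa _ _ Hy) as [t [Ht Hty]].
  apply (justified_step (s := Nat.lor s t)); [auto with claims|].
  unfold step. cbn [enc]. rewrite !nsnd_pair, !nfst_pair.
  do 6 right. left. split; auto. exists u. auto with claims.
- simpl in H. remember (nsnd x) as k eqn:Hk.
  revert x y Hk H. induction k as [|k IH]; simpl; intros x y Hk H.
  + destruct (IHa _ _ H) as [s [Hs Hsy]].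
    apply (justified_step Hs). unfold step. cbn [enc].
    rewrite !nsnd_pair, !nfst_pair. do 7 right. left. auto.
  + destruct H as [r [Hr Hy]].
    destruct (IHb _ _ Hy) as [s [Hs Hsy]].
    destruct (IH (npair (nfst x) k) r) as [t [Ht Htr]];
      [now rewrite nsnd_pair | now rewrite nfst_pair |].
    apply (justified_step (s := Nat.lor s t)); [auto with claims|].
    unfold step. cbn [enc]. rewrite !nsnd_pair, !nfst_pair.
    do 7 right. left. split; auto. right. rewrite <- Hk. split; [discriminate|].
    exists r. simpl pred. auto with claims.
- destruct H as [Hy Hi].
  (* The witnesses for the finitely many failed tests of [c_mu] are merged into one set. *)
  assert (Hj : forall j, j <= y -> exists s, justified o s /\
            forall i, i < j -> exists r, claim s (enc a) (npair x i) (S r)).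
  { induction j as [|j IH]; intros Hj.
    - exists 0. split; [apply justified_zero | intros; lia].
    - destruct IH as [s [Hs Hsi]]; [lia|]. destruct (Hi j) as [r Hr]; [lia|].
      destruct (IHa _ _ Hr) as [t [Ht Htr]].
      exists (Nat.lor s t). split; [auto with claims|]. intros i Hij.
      destruct (Nat.eq_dec i j) as [->|].
      + exists r. auto with claims.
      + destruct (Hsi i) as [r' Hr']; [lia|]. exists r'. auto with claims. }
  destruct (Hj y (le_n _)) as [s [Hs Hsi]], (IHa _ _ Hy) as [t [Ht Hty]].
  apply (justified_step (s := Nat.lor s t)); [auto with claims|].
  unfold step. cbn [enc]. rewrite !nsnd_pair, !nfst_pair.
  do 8 right. split; auto. split; [auto with claims|]. intros i Hlt.
  destruct (Hsi i Hlt) as [r Hr]. exists r. auto with claims.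
Qed.

(** * Decidability of halting witnesses *)

Lemma dec_ex_below (F : Baire -> nat -> nat) (P : Baire -> nat -> nat -> Prop) :
  (forall f x k, P f x k -> k < F f x) ->
  computable F -> dec (fun f z => P f (nfst z) (nsnd z)) ->
  dec (fun f x => exists k, P f x k).
Proof.
intros Hk HF HP. apply (dec_rel_iff (P := fun f x => exists k, k < F f x /\ P f x k)).
- intros f x. split; intros [k H]; exists k; [tauto | eauto].
- now apply dec_bounded_ex.
Qed.

(** Members lie below the canonical index and pairing dominates its components. This bounds the
    existential quantifiers of [step]. *)
Lemma claim_lt (s e x y : nat) : claim s e x y -> y < s.
Proof.
intros H. apply in_Delta_lt in H. unfold npair in H.
pose proof (Cantor.to_nat_non_decreasing x y).
pose proof (Cantor.to_nat_non_decreasing e (Cantor.to_nat (x, y))). lia.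
Qed.

Lemma dec_claim (F G H K : Baire -> nat -> nat) :
  computable F -> computable G -> computable H -> computable K ->
  dec (fun f x => claim (F f x) (G f x) (H f x) (K f x)).
Proof.
intros. apply dec_in_Delta; auto with comp.
Qed.

Hint Extern 5 (computable _) =>
  match goal with H : computable ?F |- _ => is_var F; apply (computable_comp H) end
  : comp.

Lemma dec_step (O F G H K : Baire -> nat -> nat) :
  computable O -> computable F -> computable G -> computable H -> computable K ->
  dec (fun f x => step (O f x) (F f x) (G f x) (H f x) (K f x)).
Proof.
intros HO HF HG HH HK. unfold step.
repeat apply dec_rel_or; repeat apply dec_rel_and;
  repeat apply dec_rel_or; repeat apply dec_rel_and;
  try apply dec_rel_not; try apply dec_rel_eq; try apply dec_claim; auto 20 with comp.
(* What remains are the quantified clauses for [c_pair], [c_comp], [c_prec] and [c_mu]. *)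
- apply (dec_ex_below (F := F)); auto.
  { intros f x u [Hu _]. exact (claim_lt Hu). }
  apply dec_rel_and; [apply dec_claim; auto 20 with comp|].
  apply (dec_ex_below (F := fun f z => F f (nfst z))); auto with comp.
  { intros f x v [Hv _]. exact (claim_lt Hv). }
  apply dec_rel_and; [apply dec_claim | apply dec_rel_eq]; auto 20 with comp.
- apply (dec_ex_below (F := F)); auto.
  { intros f x u [Hu _]. exact (claim_lt Hu). }
  apply dec_rel_and; apply dec_claim; auto 20 with comp.
- apply (dec_ex_below (F := F)); auto.
  { intros f x u [Hu _]. exact (claim_lt Hu). }
  apply dec_rel_and; apply dec_claim; auto 20 with comp.
- apply dec_bounded_all; auto.
  apply (dec_ex_below (F := fun f z => F f (nfst z))); auto with comp.
  { intros f x r Hr. apply claim_lt in Hr. lia. }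
  apply dec_claim; auto 20 with comp.
Qed.

Lemma dec_justified (O F : Baire -> nat -> nat) :
  computable O -> computable F -> dec (fun f x => justified (O f x) (F f x)).
Proof.
intros HO HF.
apply (dec_rel_iff (P := fun f x => forall w, w < F f x -> ~ in_Delta (F f x) w \/
  step (O f x) (F f x) (nfst w) (nfst (nsnd w)) (nsnd (nsnd w)))).
- intros f x. split.
  + intros H w Hw. destruct (H w (in_Delta_lt Hw)); tauto.
  + intros H w _. destruct (classic (in_Delta (F f x) w)); auto.
- apply dec_bounded_all; auto. apply dec_rel_or.
  + apply dec_rel_not, dec_in_Delta; auto with comp.
  + apply dec_step; auto with comp.
Qed.

(** * Halting times and the distances [delta] *)

Definition unit_ball (a : nat) : nat := npair a (rat 1 0 0).

(** [t] witnesses that the code [n], run on input [2] with the constant oracle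
    [unit_ball (2 * n)], halts. *)
Definition halts (n t : nat) : Prop :=
  justified (unit_ball (2 * n)) t /\ exists y, claim t n 2 y.

Lemma dec_halts (F G : Baire -> nat -> nat) :
  computable F -> computable G -> dec (fun f x => halts (F f x) (G f x)).
Proof.
intros HF HG. apply dec_rel_and.
- apply dec_justified; auto. unfold unit_ball. auto with comp.
- apply (dec_ex_below (F := G)); auto.
  { intros f x y. apply claim_lt. }
  apply dec_claim; auto with comp.
Qed.

(** The least [t <= k] with [halts n t], or [k] if there is none. *)
Definition halting_time (n k : nat) : nat :=
  nat_rect (fun _ => nat) 0
    (fun _ r => if excluded_middle_informative (halts n r) then r else S r) k.

Lemma computable_halting_time (F G : Baire -> nat -> nat) :
  computable F -> computable G ->
  computable (fun f x => halting_time (F f x) (G f x)).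
Proof.
intros HF HG.
apply (@computable_rect (fun _ _ => 0) G (fun f x _ r =>
  if excluded_middle_informative (halts (F f x) r) then r else S r));
  auto with comp.
apply (@computable_if (fun f z => halts (F f (nfst z)) (nsnd (nsnd z))));
  auto with comp.
apply dec_halts; auto with comp.
Qed.

Lemma halting_time_eq (n t k : nat) :
  (forall i, i < t -> ~ halts n i) -> k <= t -> halting_time n k = k.
Proof.
intros Ht. induction k as [|k IH]; intros Hk; simpl; auto.
fold (halting_time n k). rewrite IH by lia.
destruct (excluded_middle_informative _) as [H|]; auto.
exfalso. apply (Ht k); auto.
Qed.

Lemma halting_time_stable (n t k : nat) :
  halts n t -> (forall i, i < t -> ~ halts n i) -> t <= k -> halting_time n k = t.
Proof.
intros Ht Hi. induction 1 as [|k Hk IH]; [now apply halting_time_eq with t|].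
simpl. fold (halting_time n k). rewrite IH.
now destruct (excluded_middle_informative _).
Qed.

(** [delta] is [1 - 1 / (t + 2)] for the least witness [t], or [1] if there is none. Stage [k] is
    exact once [k] reaches [t]; before that it gives [1 - 1 / (k + 2)], which is off by less than
    [1 / (k + 2)]. *)
Lemma delta_exists (n : nat) : exists delta : R,
  (1 / 2 <= delta <= 1 /\
   (delta < 1 <-> exists t, halts n t) /\
   forall k, Rabs (INR (S (halting_time n k)) / INR (S (S (halting_time n k)))
                   - delta) <= / INR (S (S k)))%R.
Proof.
assert (Hdiv : forall k, (INR (S k) / INR (S (S k)) = 1 - / INR (S (S k)))%R).
{ intros k. rewrite !S_INR. pose proof (pos_INR k). field. lra. }
assert (Hinv : forall k, (0 < / INR (S (S k)) <= 1 / 2)%R).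
{ intros k. rewrite !S_INR. pose proof (pos_INR k). split.
  - apply Rinv_0_lt_compat. lra.
  - unfold Rdiv. rewrite Rmult_1_l. apply Rinv_le_contravar; lra. }
destruct (classic (exists t, halts n t)) as [H|H].
- destruct (least_witness H) as [t [Ht Hi]].
  exists (1 - / INR (S (S t)))%R. pose proof (Hinv t). split; [lra|]. split.
  { split; [auto | lra]. }
  intros k. rewrite Hdiv. destruct (Nat.le_gt_cases t k) as [Hk|Hk].
  + rewrite (halting_time_stable Ht Hi Hk), Rminus_diag, Rabs_R0.
    apply Rlt_le, Hinv.
  + rewrite (halting_time_eq Hi) by lia.
    assert (/ INR (S (S t)) <= / INR (S (S k)))%R.
    { apply Rinv_le_contravar; [apply lt_0_INR; lia | apply le_INR; lia]. }
    apply Rabs_le. lra.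
- exists 1%R. split; [lra|]. split.
  { split; [lra | tauto]. }
  intros k. rewrite Hdiv. rewrite (halting_time_eq (t := k)); auto.
  + pose proof (Hinv k). apply Rabs_le. lra.
  + intros i _ Hi. eauto.
Qed.

Definition delta (n : nat) : R :=
  proj1_sig (constructive_indefinite_description _ (delta_exists n)).

Lemma delta_bounds (n : nat) : (1 / 2 <= delta n <= 1)%R.
Proof.
exact (proj1 (proj2_sig (constructive_indefinite_description _ (delta_exists n)))).
Qed.

Lemma delta_lt_1 (n : nat) : (delta n < 1)%R <-> exists t, halts n t.
Proof.
exact (proj1 (proj2 (proj2_sig
  (constructive_indefinite_description _ (delta_exists n))))).
Qed.

(** Running [2 ^ k] stages brings the error bound [1 / (2 ^ k + 2)] below [(/ 2) ^ k]. *)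
Definition delta_approx (n k : nat) : nat :=
  rat (S (halting_time n (2 ^ k))) 0 (S (halting_time n (2 ^ k))).

Lemma delta_approx_spec (n k : nat) :
  (Rabs (Q2R (c_Q (delta_approx n k)) - delta n) <= (/ 2) ^ k)%R.
Proof.
unfold delta_approx. rewrite Q2R_rat. change (INR 0) with 0%R.
rewrite Rminus_0_r. eapply Rle_trans.
- exact (proj2 (proj2 (proj2_sig
    (constructive_indefinite_description _ (delta_exists n)))) (2 ^ k)).
- rewrite pow_inv, <- INR_pow2. apply Rinv_le_contravar.
  + apply lt_0_INR, pow2_pos.
  + apply le_INR. lia.
Qed.

(** * A computable metric space with [rho_min] not reducible to [rho_Cau] *)

Definition pair_dist (i j : nat) : R :=
  if Nat.eq_dec i j then 0%R
  else if Nat.eq_dec (Nat.div2 i) (Nat.div2 j) then delta (Nat.div2 i) else 1%R.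

Lemma pair_dist_pos (i j : nat) : (pair_dist i j >= 0)%R.
Proof.
unfold pair_dist. pose proof (delta_bounds (Nat.div2 i)).
destruct (Nat.eq_dec _ _); [lra|]. destruct (Nat.eq_dec _ _); lra.
Qed.

Lemma pair_dist_sym (i j : nat) : pair_dist i j = pair_dist j i.
Proof.
unfold pair_dist.
destruct (Nat.eq_dec i j), (Nat.eq_dec j i); try congruence.
destruct (Nat.eq_dec (Nat.div2 i) (Nat.div2 j)),
  (Nat.eq_dec (Nat.div2 j) (Nat.div2 i)); congruence.
Qed.

Lemma pair_dist_apart (i j : nat) : i <> j -> (1 / 2 <= pair_dist i j <= 1)%R.
Proof.
intros H. unfold pair_dist. pose proof (delta_bounds (Nat.div2 i)).
destruct (Nat.eq_dec i j); [contradiction|]. destruct (Nat.eq_dec _ _); lra.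
Qed.

Lemma pair_dist_same (i : nat) : pair_dist i i = 0%R.
Proof.
unfold pair_dist. now destruct (Nat.eq_dec i i).
Qed.

Lemma pair_dist_refl (i j : nat) : pair_dist i j = 0%R <-> i = j.
Proof.
split; [|intros ->; apply pair_dist_same].
intros H. destruct (Nat.eq_dec i j) as [|Hne]; auto.
pose proof (pair_dist_apart Hne). lra.
Qed.

(** Distances between distinct points lie between [1 / 2] and [1], so any two of them add up to at
    least a third. *)
Lemma pair_dist_tri (i j k : nat) : (pair_dist i j <= pair_dist i k + pair_dist k j)%R.
Proof.
destruct (Nat.eq_dec i j) as [->|Hij].
{ rewrite pair_dist_same. pose proof (pair_dist_pos j k).
  pose proof (pair_dist_pos k j). lra. }
destruct (Nat.eq_dec i k) as [->|Hik]; [rewrite pair_dist_same; lra|].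
destruct (Nat.eq_dec k j) as [->|Hkj]; [rewrite pair_dist_same; lra|].
pose proof (pair_dist_apart Hij). pose proof (pair_dist_apart Hik).
pose proof (pair_dist_apart Hkj). lra.
Qed.

Definition pair_metric : Metric_Space :=
  {| Base := nat; dist := pair_dist; dist_pos := pair_dist_pos;
     dist_sym := pair_dist_sym; dist_refl := pair_dist_refl;
     dist_tri := pair_dist_tri |}.

Lemma pair_dist_computable : exists c, forall n m k,
  exists q, eval0 c (npair n (npair m k)) q /\
            (Rabs (Q2R (c_Q q) - pair_dist n m) <= (/ 2) ^ k)%R.
Proof.
assert (H : computable (fun _ z =>
  if Nat.eq_dec (nfst z) (nfst (nsnd z)) then rat 0 0 0
  else if Nat.eq_dec (Nat.div2 (nfst z)) (Nat.div2 (nfst (nsnd z)))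
       then delta_approx (Nat.div2 (nfst z)) (nsnd (nsnd z)) else rat 1 0 0)).
{ apply (computable_if (P := fun _ z => nfst z = nfst (nsnd z)));
    [apply dec_rel_eq; auto with comp | auto with comp |].
  apply (computable_if
    (P := fun _ z => Nat.div2 (nfst z) = Nat.div2 (nfst (nsnd z))));
    [apply dec_rel_eq; auto with comp | | auto with comp].
  apply computable_rat; auto with comp;
    apply computable_S, computable_halting_time; auto with comp. }
destruct H as [c Hc]. exists c. intros n m k.
eexists. split; [apply (Hc (fun _ => 0))|]. cbv beta.
rewrite !nsnd_pair, !nfst_pair. unfold pair_dist.
pose proof (half_pow_pos k).
destruct (Nat.eq_dec n m).
{ rewrite Q2R_rat. replace ((INR 0 - INR 0) / INR 1 - 0)%R with 0%R by (simpl; field).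
  rewrite Rabs_R0. lra. }
destruct (Nat.eq_dec _ _); [apply delta_approx_spec|].
rewrite Q2R_rat. replace ((INR 1 - INR 0) / INR 1 - 1)%R with 0%R by (simpl; field).
rewrite Rabs_R0. lra.
Qed.

Definition pair_nes : nes_metric_space.
Proof.
refine {| space := pair_metric; A := fun _ => True; nu := fun n => Some n |}.
- auto.
- intros a _. now exists a.
- intros x eps Heps. exists x. simpl. now rewrite pair_dist_same.
- destruct pair_dist_computable as [c Hc]. exists c. intros n m k a b Ha Hb.
  injection Ha as <-. injection Hb as <-. apply Hc.
Defined.

Definition pair_space : computable_metric_space :=
  {| nes := pair_nes; nu_total := fun n => ex_intro _ n eq_refl |}.

Lemma radius_unit_ball (a : nat) : radius (unit_ball a) = 1%R.
Proof.
unfold radius, unit_ball. rewrite nsnd_pair, Q2R_rat. simpl. field.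
Qed.

Lemma ball_unit_ball (a x : nat) :
  ball pair_nes (unit_ball a) x <-> (pair_dist a x < 1)%R.
Proof.
unfold ball. rewrite radius_unit_ball. unfold unit_ball. rewrite nfst_pair. simpl.
split; [intros [a' [Ha Hx]] | eauto]. now injection Ha as <-.
Qed.

(** The radius [1 / 4] is below the least distance between distinct points, so the ball isolates its
    centre and can complete a finite prefix to a [rho_min]-name. *)
Definition quarter_ball (a : nat) : nat := npair a (rat 1 0 3).

Lemma ball_quarter_ball (a x : nat) : ball pair_nes (quarter_ball a) x <-> x = a.
Proof.
unfold ball, radius, quarter_ball. rewrite nfst_pair, nsnd_pair, Q2R_rat. simpl.
split.
- intros [a' [Ha Hx]]. injection Ha as <-.
  destruct (Nat.eq_dec a x) as [|Hne]; auto.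
  pose proof (pair_dist_apart Hne). lra.
- intros ->. exists a. split; auto. rewrite pair_dist_same. lra.
Qed.

Lemma pair_min_names (f : Baire) (x : nat) :
  (forall n, ball pair_nes (f n) x) ->
  (exists n, forall y, ball pair_nes (f n) y -> y = x) ->
  min_names (ball_dom pair_nes) (ball pair_nes) f x.
Proof.
intros Hf [n Hn]. split.
- intros i. split; [apply (ball_dom_of_mem (M := pair_nes) (Hf i)) | apply Hf].
- intros b _ Hb. exists (n :: nil). intros y Hy.
  now rewrite (Hn y (Hy n (or_introl eq_refl))).
Qed.

Lemma min_not_le_Cau : ~ rep_le (rho_min pair_space) (rho_Cau pair_space).
Proof.
intros [c Hc]. set (n := enc c). set (f0 := fun _ : nat => unit_ball (2 * n)).
assert (H0 : ball pair_nes (unit_ball (2 * n)) (2 * n)).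
{ apply ball_unit_ball. rewrite pair_dist_same. lra. }
assert (Hh : exists t, halts n t).
{ (* Otherwise the unit ball around [2 * n] is a singleton, and [f0] is a name. *)
  apply NNPP. intros Hno.
  assert (Hd : (1 <= delta n)%R).
  { apply Rnot_lt_le. now rewrite delta_lt_1. }
  destruct (Hc f0) as [g [Hg _]].
  - exists (2 * n). apply pair_min_names; [intros i; exact H0|].
    exists 0. intros y Hy. apply ball_unit_ball in Hy.
    destruct (Nat.eq_dec y (2 * n)) as [|Hne]; auto.
    unfold pair_dist in Hy. rewrite Nat.div2_double in Hy.
    destruct (Nat.eq_dec _ _); [congruence|]. destruct (Nat.eq_dec _ _); lra.
  - destruct (justified_complete (Hg 2)) as [t [Ht Hty]].
    apply Hno. exists t. split; eauto. }
assert (H1 : ball pair_nes (unit_ball (2 * n)) (2 * n + 1)).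
{ apply ball_unit_ball. unfold pair_dist.
  rewrite Nat.div2_double, Nat.add_1_r, Nat.div2_succ_double.
  apply delta_lt_1 in Hh.
  destruct (Nat.eq_dec _ _); [lia|]. destruct (Nat.eq_dec _ _); [auto | lia]. }
destruct Hh as [t [Ht [y Hy]]].
apply (justified_sound Ht) in Hy.
destruct (eval_use Hy) as [N HN].
assert (Hz : forall z, ball pair_nes (unit_ball (2 * n)) z -> y = z).
{ intros z Hz.
  (* [f] agrees with [f0] on the part read to compute [y], then isolates [z]. Hence the same output
     [y] serves every [z] in the unit ball. *)
  set (f := fun i => if lt_dec i N then unit_ball (2 * n) else quarter_ball z).
  assert (Hf : rho_min pair_space f z).
  { apply pair_min_names.
    - intros i. unfold f. destruct (lt_dec i N); auto. now apply ball_quarter_ball.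
    - exists N. intros x. unfold f. destruct (lt_dec N N); [lia|].
      apply ball_quarter_ball. }
  destruct (Hc f (ex_intro _ z Hf)) as [g [Hg Hgz]].
  assert (Hgy : g 2 = y).
  { apply (eval_det (Hg 2)). apply HN. intros i Hi. unfold f.
    now destruct (lt_dec i N). }
  (* Entry [2] has precision [1 / 4], below the least distance [1 / 2], so it equals [z]. This is
     why [halts] runs the code on input [2]. *)
  destruct (Cau_names_close (Hgz z Hf) 2) as [a [Ha Haz]].
  simpl in Ha, Haz. injection Ha as <-.
  destruct (Nat.eq_dec (g 2) z) as [|Hne]; [congruence|].
  pose proof (pair_dist_apart Hne). lra. }
pose proof (Hz _ H0). pose proof (Hz _ H1). lia.
Qed.

(** * A space with [rho_Cau] not reducible to [rho_max] *)

Definition one_point_metric : Metric_Space.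
Proof.
refine {| Base := unit; dist := fun _ _ => 0%R |}.
- intros; apply Rge_refl.
- reflexivity.
- intros [] []. tauto.
- intros; lra.
Defined.

(** Nonempty, and not of the form [{nfst y | c maps some i to y}] for the code
    [c] with constant oracle [0], since it differs from that set at
    [S (enc c)]. *)
Definition diagonal (n : nat) : Prop :=
  match n with
  | 0 => True
  | S m => forall c, enc c = m ->
      ~ exists i y, eval (fun _ => 0) c i y /\ nfst y = n
  end.

Definition one_point_space : nes_metric_space.
Proof.
refine {| space := one_point_metric; A := fun _ => True;
  nu := fun n => if excluded_middle_informative (diagonal n)
                 then Some tt else None |}.
- auto.
- intros [] _. exists 0.
  destruct (excluded_middle_informative _) as [|H]; [easy | now destruct H].
- intros [] eps Heps. exists tt. now split.
- exists c_zero. intros n m k a b _ _. exists 0. split; [reflexivity|]. simpl.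
  replace (Q2R (c_Q 0)) with 0%R by (unfold c_Q, Q2R; simpl; lra).
  rewrite Rminus_diag, Rabs_R0. apply Rlt_le, half_pow_pos.
Defined.

Lemma nu_one_point (n : nat) (a : unit) :
  nu one_point_space n = Some a <-> diagonal n.
Proof.
destruct a. simpl. now destruct (excluded_middle_informative (diagonal n)).
Qed.

Lemma Cau_not_le_max : ~ rep_le (rho_Cau one_point_space) (rho_max one_point_space).
Proof.
intros [c Hc].
(* [diagonal 0] holds by definition, so the constant [0] is a Cauchy name; it is also the oracle
   used in [diagonal]. *)
assert (Hp : rho_Cau one_point_space (fun _ => 0) tt).
{ exists (fun _ => tt). repeat split.
  - intros _. now apply nu_one_point.
  - intros i j _. apply half_pow_pos.
  - intros eps Heps. exists 0. intros i _. unfold Rdist. simpl.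
    now rewrite Rminus_diag, Rabs_R0. }
destruct (Hc _ (ex_intro _ tt Hp)) as [g [Hg Hmax]].
specialize (Hmax tt Hp). set (n := S (enc c)).
(* Every ball contains the only point, so the outputs of [c] are exactly the indices of balls, and
   their centres run through the domain of [nu]. *)
assert (Hn : diagonal n <-> exists i y, eval (fun _ => 0) c i y /\ nfst y = n).
{ split.
  - intros Hd. destruct (proj2 (Hmax (unit_ball n))) as [i Hi].
    + assert (Hb : ball one_point_space (unit_ball n) tt).
      { exists tt. rewrite radius_unit_ball. unfold unit_ball. rewrite nfst_pair.
        split; [now apply nu_one_point | simpl; lra]. }
      split; [exact (ball_dom_of_mem Hb) | exact Hb].
    + exists i, (g i). split; [apply Hg|]. rewrite Hi. apply nfst_pair.
  - intros [i [y [Hy <-]]]. rewrite (eval_det Hy (Hg i)).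
    destruct (proj1 (Hmax (g i)) (ex_intro _ i eq_refl)) as [_ [a [Ha _]]].
    now apply nu_one_point in Ha. }
(* Injectivity of [enc] makes [c] the only code that the definition consults at [n]. *)
assert (Hd : diagonal n <-> ~ exists i y, eval (fun _ => 0) c i y /\ nfst y = n).
{ unfold n at 1. simpl. split; [auto|].
  intros H c' Hc'. apply enc_inj in Hc'. now subst. }
tauto.
Qed.

Theorem theorem5p1 :
  ((forall M : computable_metric_space,
      rep_equiv (rho_max M) (rho_Cau M) /\
      rep_equiv (rho_Cau M) (rho_incl M) /\
      rep_le (rho_incl M) (rho_min M)) /\
   (exists M : computable_metric_space,
      ~ rep_le (rho_min M) (rho_Cau M)))
  /\
  ((forall M : nes_metric_space,
      rep_le (rho_max M) (rho_Cau M) /\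
      rep_equiv (rho_Cau M) (rho_incl M) /\
      rep_le (rho_incl M) (rho_min M)) /\
   (exists M : nes_metric_space, ~ rep_le (rho_Cau M) (rho_max M)) /\
   (exists M : nes_metric_space, ~ rep_le (rho_min M) (rho_Cau M))).
Proof.
assert (H : forall M : nes_metric_space,
  rep_le (rho_max M) (rho_Cau M) /\ rep_equiv (rho_Cau M) (rho_incl M) /\
  rep_le (rho_incl M) (rho_min M)).
{ intros M. split; [apply max_le_Cau|]. split; [|apply incl_le_min].
  split; [apply Cau_le_incl | apply incl_le_Cau]. }
split; split.
- intros M. destruct (H M) as [H1 H2]. split; auto. split; auto. apply Cau_le_max.
- exists pair_space. apply min_not_le_Cau.
- exact H.
- split; [exists one_point_space; apply Cau_not_le_max|].
  exists pair_space. apply min_not_le_Cau.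
Qed.
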